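(* Let $G$ be an infinite discrete countable group, $(X,\mu,G)$ a $G$-measure preserving system and $\alpha$ a finite partition of $X$ into sets of $\mathcal{B}_X^\mu$. Then $h^*_\mu(G,\alpha)=H_\mu(\alpha\mid\mathcal{K}_\mu(G))$.
   Context: $(X,\mu,G)$: compact metric space with $G$ acting by homeomorphisms and $G$-invariant Borel probability $\mu$; $\mathcal{B}_X^\mu$ is the $\mu$-completed Borel $\sigma$-algebra; $U_gf(x)=f(gx)$. Kronecker $\sigma$-algebra: $\mathcal{K}_\mu(G)=\{B\in\mathcal{B}_X^\mu:\{U_g1_B:g\in G\}\text{ precompact in }L^2(\mu)\}$. For a sub-$\sigma$-algebra $\mathcal{F}$, $H_\mu(\alpha\mid\mathcal{F})=\sum_{A\in\alpha}\int_X-\mathbb{E}_\mu(1_A|\mathcal{F})\log\mathbb{E}_\mu(1_A|\mathcal{F})\,d\mu$. For a sequence $\mathcal{A}=(g_n)$ in $G$, $h^{\mathcal{A}}_\mu(G,\alpha)=\limsup_n\frac1nH_\mu(\bigvee_{i=1}^ng_i^{-1}\alpha)$ with $H_\mu(\beta)=-\sum_{C\in\beta}\mu(C)\log\mu(C)$, and $h^*_\mu(G,\alpha)=\sup_{\mathcal{A}}h^{\mathcal{A}}_\mu(G,\alpha)$ over all sequences in $G$. *)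

(* Defs.v *)
From HB Require Import structures.
From mathcomp Require Import all_boot all_order all_algebra.
From mathcomp Require Import all_classical all_reals all_analysis.

Set Implicit Arguments.
Unset Strict Implicit.
Unset Printing Implicit Defensive.

Import Order.TTheory GRing.Theory Num.Theory.
Import numFieldNormedType.Exports.

Local Open Scope classical_set_scope.
Local Open Scope ring_scope.

Definition is_group {G : Type} (mul : G -> G -> G) (one : G) (inv : G -> G) :=
  [/\ (forall a b c, mul a (mul b c) = mul (mul a b) c),
      (forall a, mul one a = a), (forall a, mul a one = a),
      (forall a, mul (inv a) a = one) & (forall a, mul a (inv a) = one)].

Definition is_action {G X : Type} (mul : G -> G -> G) (one : G)
    (act : G -> X -> X) :=
  (forall x, act one x = x) /\
  (forall g h x, act (mul g h) x = act g (act h x)).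

Definition borel_type (X : ptopologicalType) : measurableType _ :=
  g_sigma_algebraType (@open X).

Section measure_defs.
Context {R : realType} {X : ptopologicalType}.
Variable mu : {measure set (borel_type X) -> \bar R}.

Definition completed_measurable : set (set X) :=
  [set A | exists B : set (borel_type X),
     measurable B /\ mu.-negligible ((A `\` B) `|` (B `\` A))].

(* the completed measure space: the Caratheodory extension of mu;
   it agrees with mu on Borel sets and is complete *)
Definition cX := caratheodory_type (mu_ext mu).
Definition mubar : {measure set cX -> \bar R} :=
  @completed_measure_extension _ _ _ mu.

(** * Conditional expectation with respect to a family of sets F
    (F is a sub-sigma-algebra of the completed one in applications) *)

Definition F_measurable_fun (F : set (set X)) (h : X -> R) :=
  forall B : set R, measurable B -> F (h @^-1` B).

Definition is_cond_exp (F : set (set X)) (f h : X -> R) :=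
  [/\ F_measurable_fun F h,
      mubar.-integrable [set: cX] (EFin \o h) &
      forall C : set cX, F C ->
        (\int[mubar]_(x in C) (h x)%:E = \int[mubar]_(x in C) (f x)%:E)%E].

(* E_mu(f | F) : a chosen version (any two versions agree mu-a.e.);
   the default 0 is never used since versions exist *)
Definition cond_exp (F : set (set X)) (f : X -> R) : X -> R :=
  match pselect (exists h, is_cond_exp F f h) with
  | left e => projT1 (cid e)
  | right _ => fun=> 0
  end.

(* phi(t) = - t log t  (note ln 0 = 0, so phi 0 = 0) *)
Definition entr_fun (t : R) : R := - (t * ln t).

Definition cond_entropy (k : nat) (A : 'I_k -> set X) (F : set (set X))
    : \bar R :=
  (\sum_(i < k) \int[mubar]_x (entr_fun (cond_exp F (\1_(A i)) x))%:E)%E.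

Definition entropy (I : finType) (B : I -> set X) : R :=
  \sum_(i : I) entr_fun (fine (mubar (B i))).

Section sequence_entropy.
Context {G : Type} (act : G -> X -> X).

(* the elements of the join \/_{i<n} s_i^{-1} alpha, indexed by the
   choice c of an element of alpha for each i (empty atoms allowed) *)
Definition join_atom (k : nat) (A : 'I_k -> set X) (s : nat -> G) (n : nat)
    (c : {ffun 'I_n -> 'I_k}) : set X :=
  [set x | forall i : 'I_n, A (c i) (act (s i) x)].

Definition seq_entropy (k : nat) (A : 'I_k -> set X) (s : nat -> G)
    : \bar R :=
  limn_esup (fun n => ((n%:R)^-1 * entropy (join_atom A s (n:=n)))%:E).

Definition seq_entropy_star (k : nat) (A : 'I_k -> set X) : \bar R :=
  ereal_sup [set seq_entropy A s | s in [set: nat -> G]].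

Definition L2_precompact (S : set (X -> R)) :=
  forall e : R, 0 < e -> exists (m : nat) (fs : 'I_m -> X -> R),
    (forall j, S (fs j)) /\
    (forall f, S f -> exists j : 'I_m,
      ('N[mubar]_(2%:E)[EFin \o (f \- fs j)%R] < e%:E)%E).

Definition kronecker : set (set X) :=
  [set B | completed_measurable B /\
     L2_precompact [set (fun x => \1_B (act g x)) | g in [set: G]]].

End sequence_entropy.

End measure_defs.

Definition is_finite_partition {R : realType} {X : ptopologicalType}
    (mu : {measure set (borel_type X) -> \bar R})
    (k : nat) (A : 'I_k -> set X) :=
  [/\ (forall i, completed_measurable mu (A i)),
      (forall i j, i != j -> A i `&` A j = set0) &
      \bigcup_i A i = [set: X]].

(* Main.v *)
Require Import Defs.
From HB Require Import structures.
From mathcomp Require Import all_boot all_order all_algebra.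
From mathcomp Require Import ring lra.
From mathcomp Require Import all_classical all_reals all_analysis measurable_realfun.

(** Write E(1_A | K) for the conditional expectations on the Kronecker algebra K
and phi(t) = - t ln t, so that the right-hand side is the sum over A of the
integrals of phi(E(1_A | K)).

Upper bound. Let beta be a finite K-measurable partition on whose atoms every
E(1_A | K) is nearly constant; then H(alpha | beta) is close to H(alpha | K).
Precompactness of the orbit of beta gives finitely many translates r_j^-1 beta
such that every g^-1 beta is close to one of them. Conditioning the join of the
g_i^-1 alpha on the join of the r_j^-1 beta, submodularity of entropy bounds the
entropy of the join by a constant plus n (H(alpha | beta) + epsilon).

Lower bound. For every finite partition eta there is g such that
H(g^-1 alpha | eta) >= H(alpha | K) - epsilon; choosing the g_i one after the
other gives the required sequence. Indeed 1_A - E(1_A | K) is orthogonal to K, so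
for a suitable g its translate is nearly orthogonal to all atoms of eta, which
allows to replace 1_A by E(1_A | K), and then Jensen's inequality applies.

Such a g exists because otherwise the kernels
sum_A f_A(gx) f_A(gy), with f_A = 1_A - E(1_A | K), and their convex combinations
have integrals against some h(x) h(y) bounded away from 0. A minimizing sequence
Q_n for the L2 norm in their convex hull is Cauchy and asymptotically invariant,
so the functions Q_n h converge to a function v whose orbit is precompact: its
level sets are in K, while v is orthogonal to K. Hence v = 0, a contradiction.
No product measure is needed since all kernels involved are finite sums of
products a(x) b(y). *)

Set Implicit Arguments.
Unset Strict Implicit.
Unset Printing Implicit Defensive.

Import Order.TTheory GRing.Theory Num.Theory.
Import numFieldNormedType.Exports.
Local Open Scope classical_set_scope.
Local Open Scope ring_scope.

Lemma indic_eq01 (T : Type) (R : pzRingType) (A : set T) x :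
  \1_A x = 0 :> R \/ \1_A x = 1 :> R.
Proof. by rewrite indicE; case: (x \in A); [right|left]. Qed.

(** The difference takes only the values -1, 0 and 1. This turns squared L2 distances between
    indicators into L1 distances, the form used for orbits of sets below. *)
Lemma indic_sub_sqr (T : Type) (R : realType) (A : set T) x y :
  (\1_A x - \1_A y) ^+ 2 = `|\1_A x - \1_A y| :> R.
Proof.
case: (indic_eq01 R A x) => ->; case: (indic_eq01 R A y) => ->;
by rewrite ?subrr ?subr0 ?sub0r ?normrN ?normr1 ?normr0 ?sqrrN ?expr1n ?expr0n.
Qed.

(** * Bounded measurable functions *)

Section bounded_measurable.
Context d (T : measurableType d) (R : realType).

(** This class is stable under sums, products and composition, and its members are integrable for a
    probability measure, so every integrability side condition reduces to it. *)
Definition bmf (f : T -> R) :=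
  measurable_fun setT f /\ exists M, forall x, `|f x| <= M.

Lemma bmf_cst (c : R) : bmf (fun _ => c).
Proof. by split; [exact: measurable_cst|exists `|c|]. Qed.

Lemma bmfD f g : bmf f -> bmf g -> bmf (fun x => f x + g x).
Proof.
move=> [mf [M Mf]] [mg [N Ng]]; split; first exact: measurable_funD.
by exists (M + N) => x; rewrite (le_trans (ler_normD _ _))// lerD.
Qed.

Lemma bmfN f : bmf f -> bmf (fun x => - f x).
Proof.
move=> [mf [M Mf]]; split; first exact: measurableT_comp.
by exists M => x; rewrite normrN.
Qed.

Lemma bmfB f g : bmf f -> bmf g -> bmf (fun x => f x - g x).
Proof. by move=> mf /bmfN; exact: bmfD. Qed.

Lemma bmfM f g : bmf f -> bmf g -> bmf (fun x => f x * g x).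
Proof.
move=> [mf [M Mf]] [mg [N Ng]]; split; first exact: measurable_funM.
by exists (M * N) => x; rewrite normrM ler_pM.
Qed.

Lemma bmfX f n : bmf f -> bmf (fun x => f x ^+ n).
Proof.
move=> bf; elim: n => [|n IH]; first exact: bmf_cst.
by under eq_fun do rewrite exprS; exact: bmfM.
Qed.

Lemma bmf_norm f : bmf f -> bmf (fun x => `|f x|).
Proof.
move=> [mf [M Mf]]; split; first exact: measurableT_comp.
by exists M => x; rewrite normr_id.
Qed.

Lemma bmf_sum (J : Type) (r : seq J) (Q : pred J) (f : J -> T -> R) :
  (forall i, bmf (f i)) -> bmf (fun x => \sum_(i <- r | Q i) f i x).
Proof.
move=> bf; elim: r => [|i r IH].
  by under eq_fun do rewrite big_nil; exact: bmf_cst.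
under eq_fun do rewrite big_cons; case: (Q i) => //.
exact: bmfD.
Qed.

Lemma indic_bool (b : T -> bool) x : \1_[set x | b x] x = (b x)%:R :> R.
Proof. by rewrite indicE mem_setE. Qed.

Lemma bmf_bool (b : T -> bool) :
  measurable [set x | b x] -> bmf (fun x => (b x)%:R).
Proof.
move=> mb; split; last first.
  by exists 1 => x; case: (b x); rewrite ?normr1 ?normr0.
rewrite (_ : (fun _ => _) = \1_[set x | b x]); first exact: measurable_indic.
by apply/funext => x; rewrite indic_bool.
Qed.

Lemma bmf_indic (A : set T) : measurable A -> bmf (\1_A).
Proof.
move=> mA; split; first exact: measurable_indic.
by exists 1 => x; rewrite indicE; case: (x \in A); rewrite ?normr1 ?normr0.
Qed.

Lemma bmf_comp (u : T -> T) f :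
  measurable_fun setT u -> bmf f -> bmf (fun x => f (u x)).
Proof.
by move=> mu [mf [M Mf]]; split; [exact: measurableT_comp|exists M].
Qed.

Lemma bmf_min f g : bmf f -> bmf g -> bmf (fun x => Num.min (f x) (g x)).
Proof.
move=> [mf [M Mf]] [mg [N Ng]]; split; first exact: measurable_minr.
exists (M + N) => x; have := Mf x; have := Ng x.
have := normr_ge0 (f x); have := normr_ge0 (g x).
by rewrite /Num.min; case: ifP => _; lra.
Qed.

Lemma bmf_max f g : bmf f -> bmf g -> bmf (fun x => Num.max (f x) (g x)).
Proof.
move=> [mf [M Mf]] [mg [N Ng]]; split; first exact: measurable_maxr.
exists (M + N) => x; have := Mf x; have := Ng x.
have := normr_ge0 (f x); have := normr_ge0 (g x).
by rewrite /Num.max; case: ifP => _; lra.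
Qed.

End bounded_measurable.
Arguments bmf {d T R} f.

(** Proves [bmf] goals by recursion on the shape of the expression, closing the leaves from the
    context. *)
Ltac bm := repeat first
  [ assumption
  | match goal with
    | |- forall _, _ => intro
    | H : forall _, bmf _ |- _ => exact (H _)
    | H : forall _ _, bmf _ |- _ => exact (H _ _)
    | |- bmf (fun x => (@?f x) - (@?g x)) => refine (bmfB _ _)
    | |- bmf (fun x => (@?f x) + (@?g x)) => refine (bmfD _ _)
    | |- bmf (fun x => - (@?f x)) => refine (bmfN _)
    | |- bmf (fun x => (@?f x) * (@?g x)) => refine (bmfM _ _)
    | |- bmf (fun x => (@?f x) ^+ _) => refine (bmfX _ _)
    | |- bmf (fun x => `|(@?f x)|) => refine (bmf_norm _)
    | |- bmf (fun x => \sum_(i <- _ | _) _) => apply: bmf_sum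
    end
  | exact (bmf_cst _ _) ].

(** * Integration of bounded functions against a probability measure *)

Section mean.
Context d (T : measurableType d) (R : realType).
Variable P : {measure set T -> \bar R}.
Hypothesis P1 : P setT = 1%E.

Definition mean (f : T -> R) : R := \int[P]_x f x.

Lemma bmf_integrable f : bmf f -> P.-integrable setT (EFin \o f).
Proof.
move=> [mf [M Mf]]; apply: measurable_bounded_integrable => //.
  by rewrite P1 ltry.
exists M; split; first by rewrite num_real.
by move=> N MN x _; exact: le_trans (Mf x) (ltW MN).
Qed.

Lemma EFin_mean f : bmf f -> (mean f)%:E = (\int[P]_x (f x)%:E)%E.
Proof. move=> bf; rewrite /mean /Rintegral fineK//.
exact: integrable_fin_num (bmf_integrable bf). Qed.

Lemma mean_cst c : mean (fun _ => c) = c.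
Proof. by rewrite /mean Rintegral_cst// P1 mulr1. Qed.

Lemma meanD f g : bmf f -> bmf g ->
  mean (fun x => f x + g x) = mean f + mean g.
Proof. by move=> bf bg; rewrite /mean RintegralD//; exact: bmf_integrable. Qed.

Lemma meanB f g : bmf f -> bmf g ->
  mean (fun x => f x - g x) = mean f - mean g.
Proof. by move=> bf bg; rewrite /mean RintegralB//; exact: bmf_integrable. Qed.

Lemma meanZ c f : bmf f -> mean (fun x => c * f x) = c * mean f.
Proof. by move=> bf; rewrite /mean RintegralZl//; exact: bmf_integrable. Qed.

Lemma meanZr c f : bmf f -> mean (fun x => f x * c) = mean f * c.
Proof. by move=> bf; rewrite /mean RintegralZr//; exact: bmf_integrable. Qed.

Lemma mean_sum (J : Type) (r : seq J) (Q : pred J) (f : J -> T -> R) :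
  (forall i, bmf (f i)) ->
  mean (fun x => \sum_(i <- r | Q i) f i x) = \sum_(i <- r | Q i) mean (f i).
Proof.
move=> bf; elim: r => [|i r IH].
  by rewrite big_nil; under [LHS]eq_Rintegral do rewrite big_nil; exact: mean_cst.
rewrite big_cons -IH /mean; under [LHS]eq_Rintegral do rewrite big_cons.
by case: (Q i) => //; rewrite -meanD//; bm.
Qed.

Lemma eq_mean f g : f =1 g -> mean f = mean g.
Proof. by move=> fg; congr mean; exact/funext. Qed.

Lemma mean_ge0 f : (forall x, 0 <= f x) -> 0 <= mean f.
Proof. by move=> f0; exact: Rintegral_ge0. Qed.

Lemma le_mean f g : bmf f -> bmf g -> (forall x, f x <= g x) ->
  mean f <= mean g.
Proof. by move=> bf bg fg; rewrite /mean le_Rintegral//; exact: bmf_integrable. Qed.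

Lemma norm_mean f : bmf f -> `|mean f| <= mean (fun x => `|f x|).
Proof. by move=> bf; rewrite /mean le_normr_Rintegral//; exact: bmf_integrable. Qed.

Lemma mean_indic A : measurable A -> mean (\1_A) = fine (P A).
Proof.
move=> mA; rewrite /mean /Rintegral integral_indic//; last by rewrite setIT.
Qed.

Lemma mean_bool (b : T -> bool) : measurable [set x | b x] ->
  mean (fun x => (b x)%:R) = fine (P [set x | b x]).
Proof.
move=> mb; rewrite -mean_indic//; by apply: eq_mean => x; rewrite indic_bool.
Qed.

Lemma mean_dist_triangle f g h : bmf f -> bmf g -> bmf h ->
  mean (fun x => `|f x - h x|) <=
  mean (fun x => `|f x - g x|) + mean (fun x => `|h x - g x|).
Proof.
move=> bf bg bh; rewrite -meanD; [|by bm..].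
apply: le_mean; [by bm..|move=> x].
by rewrite (distrC (h x)); exact: ler_distD.
Qed.

(** The quadratic form [mean P ((s f + t g)^2)] in s and t is nonnegative; two choices of (s, t)
    settle the cases a = 0 and a > 0. *)
Lemma cauchy_schwarz_mean f g : bmf f -> bmf g ->
  mean (fun x => f x * g x) ^+ 2 <=
  mean (fun x => f x ^+ 2) * mean (fun x => g x ^+ 2).
Proof.
move=> bf bg.
set a := mean (fun x => f x ^+ 2); set c := mean (fun x => g x ^+ 2).
set b := mean (fun x => f x * g x).
have q s t : 0 <= s ^+ 2 * a + 2 * s * t * b + t ^+ 2 * c.
  have := @mean_ge0 (fun x => (s * f x + t * g x) ^+ 2) (fun x => sqr_ge0 _).
  rewrite (@eq_mean _ (fun x => s ^+ 2 * f x ^+ 2 +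
    2 * s * t * (f x * g x) + t ^+ 2 * g x ^+ 2)) => [|x]; last by ring.
  rewrite (@meanD (fun x => s ^+ 2 * f x ^+ 2 + 2 * s * t * (f x * g x)))//;
    [|by bm..].
  rewrite meanD; [|by bm..].
  by rewrite !meanZ; bm.
have a0 : 0 <= a by apply: mean_ge0 => x; exact: sqr_ge0.
have c0 : 0 <= c by apply: mean_ge0 => x; exact: sqr_ge0.
have [a_eq0|aN0] := eqVneq a 0.
  (* With a = 0 this choice makes the form equal to - b^2, which forces b = 0. *)
  have := q (- (c + 1) / 2) b; rewrite a_eq0 !mulr0 add0r mul0r => h.
  have -> : b = 0; last by rewrite expr0n.
  apply/eqP; rewrite -sqrf_eq0; apply/eqP.
  have h' : b ^+ 2 <= 0 by nra.
  by apply/eqP; rewrite eq_le h' sqr_ge0.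
have a_gt0 : 0 < a by rewrite lt_neqAle eq_sym aN0.
(* At (b, - a) the form factors as a (a c - b^2). *)
have := q b (- a); rewrite (_ : _ + _ = a * (a * c - b ^+ 2)); last by ring.
by rewrite pmulr_rge0// subr_ge0.
Qed.

Lemma mean_norm_sqr f : bmf f ->
  mean (fun x => `|f x|) ^+ 2 <= mean (fun x => f x ^+ 2).
Proof.
move=> bf; have := @cauchy_schwarz_mean (fun x => `|f x|) (fun=> 1)
  (bmf_norm bf) (bmf_cst _ 1).
under eq_mean do rewrite mulr1.
under [X in _ <= X * _]eq_mean do rewrite real_normK ?num_real//.
by under [X in _ <= _ * X]eq_mean do rewrite expr1n; rewrite mean_cst mulr1.
Qed.

Lemma mean_le_sqrt f c : bmf f -> mean (fun x => f x ^+ 2) <= c ^+ 2 ->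
  0 <= c -> mean (fun x => `|f x|) <= c.
Proof.
move=> bf fc c0; rewrite -(@ler_pXn2r _ 2)// ?nnegrE//; last exact: mean_ge0.
exact: le_trans (mean_norm_sqr bf) fc.
Qed.

End mean.
Arguments mean {d T R} P f.

(** * Entropy of finite partitions *)

Section entr_fun.
Variable R : realType.
Implicit Types s t u : R.
Local Notation phi := (@entr_fun R).

Lemma entr_fun0 : phi 0 = 0.
Proof. by rewrite /entr_fun mul0r oppr0. Qed.

(* the graph of the concave function phi lies below its tangent at t *)
Lemma entr_fun_tangent u t : 0 <= u -> 0 < t -> phi u <= - (u * ln t) - u + t.
Proof.
rewrite le_eqVlt => /orP[/eqP <- t0|u0 t0].
  by rewrite entr_fun0 mul0r oppr0 !add0r ltW.
have h : ln (t / u) <= t / u - 1.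
  have := @le_ln1Dx R (t / u - 1); rewrite (addrC 1) subrK; apply.
  by rewrite ltrBDr addrC addrN divr_gt0.
rewrite ln_div ?posrE// in h.
have : u * (ln t - ln u) <= u * (t / u - 1) by rewrite ler_pM2l.
by rewrite mulrBr (mulrBr u (t / u)) mulr1 mulrCA divff ?gt_eqF// mulr1 /entr_fun; lra.
Qed.

Lemma entr_fun_ge0 u : 0 <= u <= 1 -> 0 <= phi u.
Proof. by case/andP=> u0 u1; rewrite oppr_ge0 mulr_ge0_le0// ln_le0. Qed.

Lemma entr_fun_le1 u : 0 <= u -> phi u <= 1.
Proof. by move=> u0; have := @entr_fun_tangent u 1 u0 ltr01; rewrite ln1; lra. Qed.

Lemma entr_funM s t : 0 <= s -> 0 <= t -> phi (s * t) = t * phi s + s * phi t.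
Proof.
rewrite le_eqVlt => /orP[/eqP <-|s0]; first by rewrite !mul0r entr_fun0 mulr0 addr0.
rewrite le_eqVlt => /orP[/eqP <-|t0]; first by rewrite mulr0 entr_fun0 mul0r mulr0 addr0.
by rewrite /entr_fun lnM ?posrE//; ring.
Qed.

(** With r the square root of u, the product rule gives phi (r * r) = 2 r phi r, and phi is at most
    1. *)
Lemma entr_fun_le_sqrt u : 0 <= u -> phi u <= 2 * Num.sqrt u.
Proof.
move=> u0; set r := Num.sqrt u.
have r0 : 0 <= r by exact: sqrtr_ge0.
have -> : u = r * r by rewrite -expr2 sqr_sqrtr.
rewrite entr_funM//.
have : phi r <= 1 by exact: entr_fun_le1.
move=> h; have : r * phi r <= r * 1 by rewrite ler_wpM2l.
by lra.
Qed.

(** For s <= t, monotonicity of [ln] gives phi t <= phi s + phi (t - s), and the tangent at t gives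
    phi s <= phi t + (t - s). Both increments are at most twice the square root of t - s. *)
Lemma entr_fun_unif_cont s t : 0 <= s <= 1 -> 0 <= t <= 1 ->
  `|phi s - phi t| <= 2 * Num.sqrt `|s - t|.
Proof.
wlog st : s t / s <= t.
  move=> wl hs ht; have [st|/ltW ts] := leP s t; first exact: wl.
  by rewrite distrC (distrC s); exact: wl.
move=> /andP[s0 s1] /andP[t0 t1]; rewrite (distrC s t) (@ger0_norm _ (t - s)) ?subr_ge0//.
have [u0 u1] : 0 <= t - s /\ t - s <= 1 by split; lra.
have hu := entr_fun_le_sqrt u0.
have hs : t - s <= Num.sqrt (t - s).
  rewrite -{1}(sqr_sqrtr u0) expr2 ler_piMr// ?sqrtr_ge0//.
  by rewrite -(@sqrtr1 R) ler_wsqrtr.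
have [t_eq0|tN0] := eqVneq t 0.
  have -> : s = 0 by lra.
  by rewrite t_eq0 !subrr normr0 mulr_ge0// sqrtr_ge0.
have t_gt0 : 0 < t by rewrite lt_neqAle eq_sym tN0.
have h1 : phi t <= phi s + phi (t - s).
  have lnle v : 0 <= v -> v <= t -> - (v * ln t) <= phi v.
    rewrite le_eqVlt => /orP[/eqP <-|v0 vt]; first by rewrite entr_fun0 mul0r oppr0.
    by rewrite lerN2 (ler_wpM2l (ltW v0))// ler_ln ?posrE// (lt_le_trans v0).
  have := lnle _ s0 st; have := lnle _ u0 (_ : t - s <= t).
  by rewrite /entr_fun; move=> /(_ _) h; have := h ltac:(lra); lra.
have h2 : phi s <= phi t + (t - s).
  have := entr_fun_tangent s0 t_gt0.
  have : (t - s) * ln t <= 0 by rewrite mulr_ge0_le0// ln_le0.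
  by rewrite /entr_fun; lra.
by rewrite ler_norml; apply/andP; split; lra.
Qed.

(** Each p j is at most the sum, so its logarithm is at most that of the sum. This is why merging
    atoms lowers the entropy. *)
Lemma entr_fun_sum_le (J : finType) (Q : pred J) (p : J -> R) :
  (forall j, 0 <= p j) -> phi (\sum_(j | Q j) p j) <= \sum_(j | Q j) phi (p j).
Proof.
move=> p0; rewrite /entr_fun mulr_suml -sumrN ler_sum// => j Qj.
have := p0 j; rewrite le_eqVlt => /orP[/eqP <-|pj0]; first by rewrite !mul0r.
rewrite lerN2 (ler_wpM2l (ltW pj0))// ler_ln ?posrE//.
  by rewrite (bigD1 j)//= lerDl sumr_ge0.
by rewrite (bigD1 j)//= ltr_wpDr// sumr_ge0.
Qed.

(** Nonnegativity of mutual information in homogeneous form: the total mass need not be 1, so that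
    the inequality can be applied on a single atom of a conditioning partition. *)
Lemma entr_fun_subadditive (I J : finType) (q : I -> J -> R) :
  (forall i j, 0 <= q i j) ->
  \sum_i \sum_j phi (q i j) + phi (\sum_i \sum_j q i j) <=
  \sum_i phi (\sum_j q i j) + \sum_j phi (\sum_i q i j).
Proof.
move=> q0.
set r := fun i => \sum_j q i j; set c := fun j => \sum_i q i j.
set s := \sum_i \sum_j q i j.
have r0 i : 0 <= r i by exact: sumr_ge0.
have c0 j : 0 <= c j by exact: sumr_ge0.
have s0 : 0 <= s by apply: sumr_ge0 => i _; exact: r0.
have sc : s = \sum_j c j by rewrite /s exchange_big.
(* The tangent is taken at r i * c j / s, the value that q i j would have under independence with
   the same marginals. *)
have key i j : phi (q i j) <= - (q i j * ln (r i)) - q i j * ln (c j)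
    + q i j * ln s - q i j + r i * c j / s.
  have := q0 i j; rewrite le_eqVlt => /orP[/eqP <-|qij].
    by rewrite entr_fun0 !mul0r !oppr0 !add0r !divr_ge0// mulr_ge0.
  have ri : 0 < r i by rewrite (lt_le_trans qij)// /r (bigD1 j)//= lerDl sumr_ge0.
  have cj : 0 < c j by rewrite (lt_le_trans qij)// /c (bigD1 i)//= lerDl sumr_ge0.
  have s_gt0 : 0 < s.
    by rewrite (lt_le_trans ri)// /s (bigD1 i)//= lerDl sumr_ge0// => k _; exact: r0.
  have := @entr_fun_tangent (q i j) (r i * c j / s) (q0 i j).
  have -> : ln (r i * c j / s) = ln (r i) + ln (c j) - ln s.
    by rewrite ln_div ?lnM ?posrE ?mulr_gt0.
  by move=> /(_ (divr_gt0 (mulr_gt0 ri cj) s_gt0)); lra.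
have ss : s * s / s <= s.
  by have [->|sN0] := eqVneq s 0; [rewrite !mul0r|rewrite mulfK].
have : \sum_i \sum_j phi (q i j) <= \sum_i \sum_j (- (q i j * ln (r i))
    - q i j * ln (c j) + q i j * ln s - q i j + r i * c j / s).
  by apply: ler_sum => i _; apply: ler_sum => j _; exact: key.
have -> : \sum_i \sum_j (- (q i j * ln (r i))
    - q i j * ln (c j) + q i j * ln s - q i j + r i * c j / s) =
    \sum_i phi (r i) + \sum_j phi (c j) + s * ln s - s + s * s / s.
  under eq_bigr do rewrite !big_split /=.
  rewrite !big_split /=; congr (_ + _ + _ + _ + _).
  - apply: eq_bigr => i _; rewrite sumrN -mulr_suml; reflexivity.
  - rewrite exchange_big; apply: eq_bigr => j _; rewrite sumrN -mulr_suml; reflexivity.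
  - rewrite /s mulr_suml; apply: eq_bigr => i _; rewrite mulr_suml; reflexivity.
  - rewrite -sumrN; apply: eq_bigr => i _; by rewrite sumrN.
  - under eq_bigr do rewrite -mulr_suml -mulr_sumr -sc.
    by rewrite -mulr_suml -mulr_suml.
rewrite /(phi s) /entr_fun; lra.
Qed.

End entr_fun.

(** * Entropy of labelled partitions and submodularity *)

Section label_entropy.
Context d (T : measurableType d) (R : realType).
Variable P : {measure set T -> \bar R}.
Hypothesis P1 : P setT = 1%E.
Local Notation phi := (@entr_fun R).

(* A finite partition is encoded by the function f : T -> J sending a point to the
index of its atom, so that the join of two partitions is fun x => (f x, g x). *)
Definition mlab (J : finType) (f : T -> J) :=
  forall j, measurable [set x | f x == j].

Definition pr (J : finType) (f : T -> J) (j : J) : R :=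
  mean P (fun x => (f x == j)%:R).

(** Shannon entropy of the partition into the fibres of f. Conditional entropy gets no separate
    definition: H(f | h) is always written as the entropy of the pair (f, h) minus that of h. *)
Definition H (J : finType) (f : T -> J) : R := \sum_j phi (pr f j).

Lemma mlab_bmf (J : finType) (f : T -> J) j : mlab f ->
  bmf (fun x => (f x == j)%:R : R).
Proof. by move=> mf; apply: bmf_bool; exact: mf. Qed.

Lemma mlab_set (J : finType) (f : T -> J) (Q : pred J) : mlab f ->
  measurable [set x | Q (f x)].
Proof.
move=> mf; rewrite (_ : [set x | _] = \big[setU/set0]_(j | Q j) [set x | f x == j]).
  by apply: bigsetU_measurable => j _; exact: mf.
apply/seteqP; split => [x /= Qx|x]; rewrite -bigcup_seq_cond/=.
  by exists (f x) => //=; rewrite mem_index_enum.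
by move=> [j /= /andP[_ Qj] /eqP fj]; rewrite fj.
Qed.

Lemma mlab_comp (J L : finType) (f : T -> J) (u : J -> L) : mlab f ->
  mlab (fun x => u (f x)).
Proof. by move=> mf l; exact: (@mlab_set _ _ (fun j => u j == l)). Qed.

Lemma mlab_pair (J L : finType) (f : T -> J) (g : T -> L) : mlab f -> mlab g ->
  mlab (fun x => (f x, g x)).
Proof.
move=> mf mg [j l]; rewrite (_ : [set x | _] = [set x | f x == j] `&` [set x | g x == l]).
  exact: measurableI.
by apply/seteqP; split => x /=; rewrite xpair_eqE => /andP.
Qed.

Lemma mlab_ffun (I J : finType) (f : I -> T -> J) : (forall i, mlab (f i)) ->
  mlab (fun x => [ffun i => f i x]).
Proof.
move=> mf c; rewrite (_ : [set x | _] = \bigcap_(i in [set: I]) [set x | f i x == c i]).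
  by apply: fin_bigcap_measurable => // i _; exact: mf.
apply/seteqP; split => [x /= /eqP <- i _ /=|x /= h]; first by rewrite ffunE.
by apply/eqP/ffunP => i; rewrite ffunE; apply/eqP; exact: h.
Qed.

Lemma pr_ge0 (J : finType) (f : T -> J) j : 0 <= pr f j.
Proof. by apply: mean_ge0 => x; exact: ler0n. Qed.

Lemma pr_le1 (J : finType) (f : T -> J) j : mlab f -> pr f j <= 1.
Proof.
move=> mf; rewrite -(mean_cst P1 1); apply: le_mean => //.
- exact: mlab_bmf.
- exact: bmf_cst.
- by move=> x; rewrite lern1 leq_b1.
Qed.

Lemma pr_comp (J L : finType) (f : T -> J) (u : J -> L) l : mlab f ->
  pr (fun x => u (f x)) l = \sum_(j | u j == l) pr f j.
Proof.
move=> mf; rewrite -mean_sum//; last by move=> j; exact: mlab_bmf.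
apply: eq_mean => x; have [uf|uf] := boolP (u (f x) == l).
  rewrite (bigD1 (f x))//= eqxx big1 ?addr0// => j /andP[_ /negbTE].
  by rewrite eq_sym => ->.
rewrite big1// => j /eqP uj; case: eqP => // fj.
by rewrite fj uj eqxx in uf.
Qed.

Lemma pr_pair2 (J L : finType) (f : T -> J) (g : T -> L) l : mlab f -> mlab g ->
  pr g l = \sum_j pr (fun x => (f x, g x)) (j, l).
Proof.
move=> mf mg; rewrite -mean_sum//; last by move=> j; exact/mlab_bmf/mlab_pair.
apply: eq_mean => x; rewrite (bigD1 (f x))//= xpair_eqE eqxx big1 ?addr0//.
by move=> j /negbTE; rewrite xpair_eqE eq_sym => ->.
Qed.

Lemma H_ge0 (J : finType) (f : T -> J) : mlab f -> 0 <= H f.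
Proof.
by move=> mf; apply: sumr_ge0 => j _; rewrite entr_fun_ge0// pr_ge0 pr_le1.
Qed.

(** Each atom of g is a union of atoms of f. *)
Lemma H_factor (J L : finType) (f : T -> J) (g : T -> L) (u : J -> L) :
  mlab f -> g =1 (fun x => u (f x)) -> H g <= H f.
Proof.
move=> mf gu; have -> : g = (fun x => u (f x)) by exact/funext.
rewrite /H [leRHS](partition_big u predT)//=; apply: ler_sum => l _.
by rewrite pr_comp//; apply: entr_fun_sum_le => j; exact: pr_ge0.
Qed.

(** Conditional mutual information of f and g given h is nonnegative: [entr_fun_subadditive] is
    applied on each atom l of h and the results are summed. *)
Lemma H_submod (I J L : finType) (f : T -> I) (g : T -> J) (h : T -> L) :
  mlab f -> mlab g -> mlab h ->
  H (fun x => (f x, (g x, h x))) + H h <=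
  H (fun x => (f x, h x)) + H (fun x => (g x, h x)).
Proof.
move=> mf mg mh; have mgh := mlab_pair mg mh; have mfh := mlab_pair mf mh.
pose q l i j := pr (fun x => (f x, (g x, h x))) (i, (j, l)).
have q0 l i j : 0 <= q l i j by exact: pr_ge0.
have e1 : H (fun x => (f x, (g x, h x))) = \sum_l \sum_i \sum_j phi (q l i j).
  rewrite /H; transitivity (\sum_i \sum_jl phi (pr (fun x => (f x, (g x, h x))) (i, jl))).
    by rewrite pair_bigA; apply: eq_bigr => -[].
  rewrite [RHS]exchange_big; apply: eq_bigr => i _.
  rewrite exchange_big pair_bigA; by apply: eq_bigr => -[].
have qgh l j : pr (fun x => (g x, h x)) (j, l) = \sum_i q l i j.
  by rewrite (pr_pair2 _ mf mgh).
have qfh l i : pr (fun x => (f x, h x)) (i, l) = \sum_j q l i j.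
  rewrite (@pr_pair2 _ _ g (fun x => (f x, h x)))//.
  apply: eq_bigr => j _; apply: eq_mean => x; congr (_%:R).
  by rewrite !xpair_eqE andbCA.
have qh l : pr h l = \sum_i \sum_j q l i j.
  by rewrite (pr_pair2 _ mf mh); apply: eq_bigr => i _.
have e2 : H h = \sum_l phi (\sum_i \sum_j q l i j).
  by apply: eq_bigr => l _; rewrite qh.
have e3 : H (fun x => (f x, h x)) = \sum_l \sum_i phi (\sum_j q l i j).
  rewrite exchange_big pair_bigA; apply: eq_bigr => -[i l] _ /=.
  by rewrite qfh.
have e4 : H (fun x => (g x, h x)) = \sum_l \sum_j phi (\sum_i q l i j).
  rewrite exchange_big pair_bigA; apply: eq_bigr => -[j l] _ /=.
  by rewrite qgh.
rewrite e1 e2 e3 e4 -!big_split /=; apply: ler_sum => l _.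
by apply: entr_fun_subadditive.
Qed.

Definition join (J : finType) (f : nat -> T -> J) n x : {ffun 'I_n -> J} :=
  [ffun i : 'I_n => f i x].

(** The new value sits at [ord_max], the older ones at the indices lifted past it, so that a join of
    n + 1 labels is a function of the last label and the join of the first n. *)
Definition ffun_rcons (J : finType) n (p : J * {ffun 'I_n -> J}) :
  {ffun 'I_n.+1 -> J} :=
  [ffun i => if unlift ord_max i is Some j then p.2 j else p.1].

Lemma join_rcons (J : finType) (f : nat -> T -> J) n x :
  join f n.+1 x = ffun_rcons (f n x, join f n x).
Proof.
apply/ffunP => i; rewrite !ffunE; case: unliftP => [j ->|->] //=.
by rewrite ffunE /bump leqNgt ltn_ord.
Qed.

Lemma mlab_join (J : finType) (f : nat -> T -> J) n : (forall i, mlab (f i)) ->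
  mlab (join f n).
Proof. by move=> mf; apply: mlab_ffun => i; exact: mf. Qed.

(** Chain rule relative to c: by submodularity the label f n adds at most its own conditional
    entropy given c. *)
Lemma H_join_le (J L : finType) (f : nat -> T -> J) (c : T -> L) n :
  (forall i, mlab (f i)) -> mlab c ->
  H (fun x => (join f n x, c x)) <=
  H c + \sum_(i < n) (H (fun x => (f i x, c x)) - H c).
Proof.
move=> mf mc; elim: n => [|n IH].
  rewrite big_ord0 addr0.
  (* There is a single finite function on ['I_0], whatever value is written in it. *)
  apply: (@H_factor _ _ _ _ (fun l => ([ffun i => f 0%N point], l))) => //.
  by move=> x; congr pair; apply/ffunP => -[].
have mj : mlab (join f n) by exact: mlab_join.
rewrite big_ord_recr /=.
have := H_submod (mf n) mj mc.
have : H (fun x => (join f n.+1 x, c x)) <= H (fun x => (f n x, (join f n x, c x))).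
  apply: (@H_factor _ _ _ _ (fun p => (ffun_rcons (p.1, p.2.1), p.2.2))).
    by apply: mlab_pair => //; exact: mlab_pair.
  by move=> x /=; rewrite join_rcons.
lra.
Qed.

End label_entropy.

(** * Limits of minimizing sequences *)

Section limits.
Variable R : realType.

(** The global bound M makes the tail suprema and their infimum genuine real numbers; only the tail
    from n on decides between which bounds the limit lies. *)
Lemma limn_sup_between (u : nat -> R) (M a b : R) (n : nat) :
  (forall k, `|u k| <= M) -> (forall k, (n <= k)%N -> a <= u k <= b) ->
  a <= limn_sup u <= b.
Proof.
move=> uM uab.
have bu : bounded_fun u.
  exists M; split; first by rewrite num_real.
  by move=> N MN k _; exact: le_trans (uM k) (ltW MN).
have uM' k : - M <= u k <= M by rewrite -ler_norml.
have hub k : has_ubound (sdrop u k).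
  by exists M => _ [m _ <-]; have /andP[] := uM' m.
have usup k m : (k <= m)%N -> u m <= sups u k.
  by move=> km; apply: ub_le_sup => //; exists m.
rewrite limn_supE//; apply/andP; split.
  apply: lb_le_inf; first by exists (sups u 0%N); exists 0%N.
  move=> _ [k _ <-]; rewrite (le_trans _ (usup k (maxn n k) (leq_maxr _ _)))//.
  by have /andP[] := uab (maxn n k) (leq_maxl _ _).
apply: (@le_trans _ _ (sups u n)).
  apply: ge_inf; last by exists n.
  exists (- M) => _ [k _ <-]; rewrite (le_trans _ (usup k k (leqnn _)))//.
  by have /andP[] := uM' k.
apply: ge_sup; first by exists (u n); exists n => /=.
by move=> _ [k nk <-]; have /andP[] := uab k nk.
Qed.

Lemma geometric_small (C e : R) : 0 < e -> exists n, C * 2^-1 ^+ n < e.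
Proof.
move=> e0; have C0 : 0 < `|C| + 1 by rewrite ltr_wpDl.
have : (2^-1 : R) ^+ n @[n --> \oo] --> 0.
  by apply: cvg_expr; rewrite ger0_norm ?invr_ge0// invf_lt1// ltr1n.
move/cvgrPdist_lt => /(_ (e / (`|C| + 1)) (divr_gt0 e0 C0))[n _ /(_ n (leqnn n))].
rewrite sub0r normrN ltr_pdivlMr// => hn; exists n.
apply: le_lt_trans (ler_norm _) _; rewrite normrM mulrC.
by apply: le_lt_trans hn; rewrite mulrDr mulr1 lerDl normr_ge0.
Qed.

Lemma le_of_le_add_geometric (x y C : R) :
  (forall n, x <= y + C * 2^-1 ^+ n) -> x <= y.
Proof.
move=> h; apply/ler_addgt0Pr => e e0.
have [n hn] := geometric_small C e0.
by apply: le_trans (h n) _; rewrite lerD2l ltW.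
Qed.

Lemma exprV4 n : (4^-1 : R) ^+ n = (2^-1 ^+ n) ^+ 2.
Proof. by rewrite exprAC; congr (_ ^+ _); rewrite expr2 -invfM -natrM. Qed.

(** The rate 4^-n is chosen for squared norms: after the parallelogram law, consecutive terms are at
    distance of order 2^-n, which is summable. *)
Lemma minimizing_sequence (V : Type) (C : set V) (q : V -> R) :
  C !=set0 -> (forall a, C a -> 0 <= q a) ->
  exists D (u : nat -> V), (forall a, C a -> D <= q a) /\
    forall n, C (u n) /\ q (u n) <= D + 4^-1 ^+ n.
Proof.
move=> [a0 Ca0] q0; pose S := [set q a | a in C].
have Sinf : has_inf S.
  split; first by exists (q a0); exists a0.
  by exists 0 => _ [a Ca <-]; exact: q0.
have /choice[u hu] n : exists a, C a /\ q a <= inf S + 4^-1 ^+ n.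
  have e0 : 0 < (4^-1 : R) ^+ n by rewrite exprn_gt0// invr_gt0.
  by have [_ [a Ca <-] /ltW qa] := inf_adherent e0 Sinf; exists a.
exists (inf S), u; split => // a Ca.
by apply: ge_inf; [exact: Sinf.2|exists a].
Qed.

End limits.

(** * Limits of sequences with geometrically small L1 increments *)

Section L1_limit.
Context d (T : measurableType d) (R : realType).
Variable P : {measure set T -> \bar R}.
Hypothesis P1 : P setT = 1%E.
Variables (v : nat -> T -> R) (M C : R).
Hypotheses (mv : forall n, measurable_fun setT (v n))
  (vM : forall n x, `|v n x| <= M).

(** The pointwise upper limit stands for the L1 limit: it is defined everywhere, measurable for the
    same sigma-algebra as the sequence, and keeps uniform bounds. *)
Definition sup_limit x := limn_sup (v ^~ x).

Lemma sup_limit_between a b :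
  (forall n x, a <= v n x <= b) -> forall x, a <= sup_limit x <= b.
Proof.
by move=> h x; apply: (@limn_sup_between _ (v ^~ x) M a b 0) => k.
Qed.

Lemma bmf_sup_limit : bmf sup_limit.
Proof.
split; last first.
  exists M => x; rewrite ler_norml; apply: sup_limit_between => n y.
  by rewrite -ler_norml.
apply: measurable_fun_limn_sup => // x _.
- by exists M => _ [n _ <-]; exact: le_trans (ler_norm _) (vM n x).
- exists (- M) => _ [n _ <-]; have := vM n x.
  by rewrite ler_norml => /andP[].
Qed.

Let bv n : bmf (v n). Proof. by split => //; exists M. Qed.

Hypothesis vC : forall n, mean P (fun x => `|v n.+1 x - v n x|) <= C * 2^-1 ^+ n.

(** Telescoping bounds the distance from v n x to every later term by the series, and the bound
    passes to the upper limit. *)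
Lemma sup_limit_dist_le n x :
  ((`|v n x - sup_limit x|)%:E <=
   \sum_(m <oo) (`|v (n + m).+1 x - v (n + m)%N x|)%:E)%E.
Proof.
set S := (X in (_ <= X)%E).
have S0 : (0 <= S)%E by apply: nneseries_ge0 => m _ _; rewrite lee_fin.
have hS m : ((`|v (n + m)%N x - v n x|)%:E <= S)%E.
  apply: le_trans (@nneseries_lim_ge _ _ xpredT 0 m _); last first.
    by move=> k _ _; rewrite lee_fin.
  rewrite sumEFin lee_fin; elim: m => [|m IH].
    by rewrite addn0 subrr normr0 big_geq.
  rewrite big_nat_recr//= addnS; apply: le_trans (ler_distD (v (n + m)%N x) _ _) _.
  by rewrite [leRHS]addrC lerD2l.
(* Where the series diverges the bound is trivial; elsewhere its sum is a real number r. *)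
move: S0 hS; case: S => [r|_ _|//]; last by rewrite leey.
rewrite lee_fin => r0 hr; rewrite lee_fin distrC ler_distl.
apply: (@limn_sup_between _ (v ^~ x) M _ _ n) => [//|k nk].
by have := hr (k - n)%N; rewrite subnKC// lee_fin ler_distl.
Qed.

(** The pointwise telescoping bound is integrated term by term, and the geometric series of ratio
    1/2 starting at n sums to twice its first term. *)
Lemma mean_sup_limit_le n :
  mean P (fun x => `|v n x - sup_limit x|) <= 2 * C * 2^-1 ^+ n.
Proof.
have bw := bmf_sup_limit.
rewrite -lee_fin EFin_mean//; last by bm.
have mterm m : measurable_fun setT (fun x => (`|v (n + m).+1 x - v (n + m)%N x|)%:E).
  by apply/measurable_EFinP; exact: (bmf_norm (bmfB (bv _) (bv _))).1.
apply: (@le_trans _ _ (\int[P]_x \sum_(m <oo) (`|v (n + m).+1 x - v (n + m)%N x|)%:E)%E).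
  apply: ge0_le_integral => //.
  - by apply/measurable_EFinP; exact: (bmf_norm (bmfB (bv _) bw)).1.
  - by apply: ge0_emeasurable_sum => // k x _ _; rewrite lee_fin.
  - by move=> x _; exact: sup_limit_dist_le.
rewrite integral_nneseries//.
apply: lime_le.
  by apply: is_cvg_nneseries => m _ _; apply: integral_ge0 => x _; rewrite lee_fin.
apply: nearW => N.
have le1 : \sum_(0 <= m < N) (C * 2^-1 ^+ (n + m)) <= 2 * C * 2^-1 ^+ n.
  have C0 : 0 <= C.
    by have := le_trans (mean_ge0 P (fun x => normr_ge0 _)) (vC 0); rewrite expr0 mulr1.
  suff -> : \sum_(0 <= m < N) (C * 2^-1 ^+ (n + m)) =
      2 * C * 2^-1 ^+ n - 2 * C * 2^-1 ^+ (n + N).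
    by rewrite lerBlDr lerDl !mulr_ge0// exprn_ge0// invr_ge0.
  elim: N => [|N IH]; first by rewrite big_geq// addn0 subrr.
  by rewrite big_nat_recr//= IH addnS exprS; field.
apply: le_trans (_ : (\sum_(0 <= m < N) (C * 2^-1 ^+ (n + m))%:E <= _)%E); last first.
  by rewrite sumEFin lee_fin.
apply: lee_sum => m _; rewrite -EFin_mean//; last by bm.
by rewrite lee_fin.
Qed.

End L1_limit.

(** * Conditional expectations *)

Section sub_sigma_algebra.
Context d (T : measurableType d) (R : realType).
Variable P : {measure set T -> \bar R}.
Hypothesis P1 : P setT = 1%E.
Variable K : set (set T).
Hypothesis sK : sigma_algebra setT K.
Hypothesis Kmeas : forall B, K B -> measurable B.

(** Measurability for K is expressed through the type carrying the sigma-algebra generated by K, so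
    that all closure lemmas for [bmf] apply to it directly. *)
Definition bmfK (f : T -> R) := @bmf _ (g_sigma_algebraType K) R f.

Lemma sigma_algebra_measurableE (B : set T) :
  @measurable _ (g_sigma_algebraType K) B = K B.
Proof. by rewrite /measurable/= sigma_algebra_id. Qed.

Lemma bmfK_bmf f : bmfK f -> bmf f.
Proof.
move=> [mf bf]; split => // _ Y mY.
by have := mf measurableT Y mY; rewrite sigma_algebra_measurableE => /Kmeas.
Qed.

Lemma bmfK_preimage f (Y : set R) : bmfK f -> measurable Y -> K (f @^-1` Y).
Proof.
move=> [mf _] mY; have := mf measurableT Y mY.
by rewrite sigma_algebra_measurableE setTI.
Qed.

Lemma bmfK_gt f c : bmfK f -> K [set x | c < f x].
Proof.
move=> /bmfK_preimage /(_ (measurable_itv `]c, +oo[)).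
by congr K; apply/seteqP; split => x /=; rewrite in_itv/= andbT.
Qed.

Lemma bmfK_lt f c : bmfK f -> K [set x | f x < c].
Proof.
move=> /bmfK_preimage /(_ (measurable_itv `]-oo, c[)).
by congr K; apply/seteqP; split => x /=; rewrite in_itv.
Qed.

Lemma bmfK_indic (B : set T) : K B -> bmfK \1_B.
Proof. by rewrite -sigma_algebra_measurableE => KB; exact: bmf_indic. Qed.

(** The absolute value of w is w tested against the indicator of its positive set minus w tested
    against that of its negative set. *)
Lemma mean_norm_eq0 (w : T -> R) : bmf w ->
  K [set x | 0 < w x] -> K [set x | w x < 0] ->
  (forall B, K B -> mean P (fun x => \1_B x * w x) = 0) ->
  mean P (fun x => `|w x|) = 0.
Proof.
move=> bw Kp Kn w0.
rewrite (@eq_mean _ _ _ _ _ (fun x => \1_[set x | 0 < w x] x * w x -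
  \1_[set x | w x < 0] x * w x)).
  rewrite meanB//; [|by apply: bmfM => //; exact/bmf_indic/Kmeas..].
  by rewrite !w0// subrr.
move=> x; rewrite !indic_bool.
by case: (ltrgt0P (w x)) => [||->]; rewrite ?mul1r ?mul0r ?subr0 ?sub0r.
Qed.

(* e minimizes the L2 distance to the indicator of A. *)
Lemma cond_exp_exists (A : set T) : measurable A ->
  exists e, [/\ bmfK e, forall x, 0 <= e x <= 1 &
    forall B, K B -> mean P (fun x => \1_B x * (\1_A x - e x)) = 0].
Proof.
move=> mA; have bA : bmf (\1_A : T -> R) by exact: bmf_indic.
pose q (w : T -> R) := mean P (fun x => (\1_A x - w x) ^+ 2).
have [|w _|D [u [Dle uD]]] := @minimizing_sequence R _ [set w | bmfK w] q.
- by exists (fun=> 0); exact: bmf_cst.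
- by apply: mean_ge0 => x; exact: sqr_ge0.
(* Clipping to [0, 1] keeps K-measurability and does not increase the distance to an indicator. *)
pose w n x := Num.min 1 (Num.max 0 (u n x)).
have w01 n x : 0 <= w n x <= 1.
  by rewrite /w le_min ler01 le_max lexx/= ge_min lexx.
have bKw n : bmfK (w n).
  apply: bmf_min; first exact: bmf_cst.
  by apply: bmf_max; [exact: bmf_cst|exact: (uD n).1].
have bw n : bmf (w n) by exact: bmfK_bmf.
have qw n : q (w n) <= D + 4^-1 ^+ n.
  apply: le_trans (uD n).2; have bu := bmfK_bmf (uD n).1.
  apply: le_mean => //; [by bm..|move=> x].
  have := indic_eq01 R A x.
  rewrite /w /Num.min /Num.max; case: (ltP 0 (u n x)) => hx; case: ltP => h1 []->; nra.
have wN n x : `|w n x| <= 1.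
  by have /andP[w0 w1] := w01 n x; rewrite ger0_norm.
have wC n : mean P (fun x => `|w n.+1 x - w n x|) <= 2 * 2^-1 ^+ n.
  apply: mean_le_sqrt => //; [by bm|].
  (* The midpoint competes in the minimization, so the parallelogram law bounds the squared distance
     by 2 * 4^-(n+1) + 2 * 4^-n, which is at most (2 * 2^-n)^2. *)
  have bmid : bmfK (fun x => 2^-1 * (w n.+1 x + w n x)).
    exact: (bmfM (bmf_cst _ _) (bmfD (bKw _) (bKw _))).
  have := Dle _ bmid; have := qw n; have := qw n.+1.
  rewrite (@eq_mean _ _ _ _ (fun x => (w n.+1 x - w n x) ^+ 2) (fun x =>
    2 * (\1_A x - w n.+1 x) ^+ 2 + 2 * (\1_A x - w n x) ^+ 2 -
    4 * (\1_A x - 2^-1 * (w n.+1 x + w n x)) ^+ 2)); last by move=> x; field.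
  rewrite meanB//; [|by bm..]; rewrite meanD//; [|by bm..].
  rewrite !meanZ//; [|by bm..]; rewrite -/(q _) -/(q _) -/(q _).
  rewrite exprMn -exprV4 exprS.
  have : 0 <= (4^-1 : R) ^+ n by rewrite exprn_ge0// invr_ge0.
  by set X := _ ^+ n; lra.
pose e := sup_limit w.
have be : bmfK e.
  by apply: (@bmf_sup_limit _ (g_sigma_algebraType K) R w 1) => // n; exact: (bKw n).1.
have be' := bmfK_bmf be.
have e01 : forall x, 0 <= e x <= 1 by apply: (@sup_limit_between _ T R w 1).
have qe : q e <= D.
  (* The 9 collects 1 from 4^-n <= 2^-n and 8 from twice the L1 distance bound 4 * 2^-n. *)
  apply: (@le_of_le_add_geometric _ _ _ 9) => n.
  have h1 := @mean_sup_limit_le _ T R P P1 w 1 2 (fun n => (bw n).1) wN wC n.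
  (* The difference of the two squares is (w n - e) (2 * 1_A - e - w n), whose second factor is at
     most 2 in absolute value. *)
  have h2 : q e <= q (w n) + 2 * mean P (fun x => `|w n x - e x|).
    rewrite -meanZ//; [|by bm]; rewrite -meanD//; [|by bm..].
    apply: le_mean => //; [by bm..|move=> x].
    have /andP[e0 e1] := e01 x; have /andP[w0 w1] := w01 n x.
    have := ler_norm (w n x - e x); have := ler_norm (- (w n x - e x)).
    rewrite normrN; set N := `|_| => N1 N2.
    have h : 0 <= N by exact: normr_ge0.
    have h0 : 0 <= (N - (e x - w n x)) * (e x + w n x) by apply: mulr_ge0; lra.
    have h0' : 0 <= N * (2 - (e x + w n x)) by apply: mulr_ge0; lra.
    have h1' : 0 <= (N - (w n x - e x)) * (2 - (e x + w n x)) by apply: mulr_ge0; lra.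
    have h1'' : 0 <= N * (e x + w n x) by apply: mulr_ge0; lra.
    by case: (indic_eq01 R A x) => ->; lra.
  have h3 : (4^-1 : R) ^+ n <= 2^-1 ^+ n.
    rewrite exprV4 expr2 ler_piMr// ?exprn_ge0// ?invr_ge0//.
    by rewrite exprn_ile1// ?invr_ge0// invf_le1// ler1n.
  by have := qw n; rewrite -/e in h1; lra.
exists e; split => // B KB.
have bB : bmf (\1_B : T -> R) by exact/bmf_indic/Kmeas.
set c := mean _ _.
(* Perturbing e by c times the indicator of B, with c the integral to be shown zero, changes q by -
   2 c^2 + c^2 P(B). Minimality together with P(B) <= 1 gives c = 0. *)
have bt : bmfK (fun x => e x + c * \1_B x).
  exact: (bmfD be (bmfM (bmf_cst _ _) (bmfK_indic KB))).
have := Dle _ bt; rewrite /q.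
rewrite (@eq_mean _ _ _ _ _ (fun x => (\1_A x - e x) ^+ 2 -
   (2 * c) * (\1_B x * (\1_A x - e x)) + c ^+ 2 * (\1_B x))); last first.
  by move=> x; case: (indic_eq01 R B x) => ->; ring.
rewrite meanD//; [|by bm..]; rewrite meanB//; [|by bm..].
rewrite !meanZ//; [|by bm..]; rewrite -/(q _) -/c.
have : mean P (\1_B) <= 1.
  rewrite -(mean_cst P1 1); apply: le_mean => //; first exact: bmf_cst.
set p := mean P _ => p1 h.
have : c ^+ 2 * p <= c ^+ 2 by rewrite ler_piMr// sqr_ge0.
move=> h'; have : c ^+ 2 <= 0 by lra.
by move=> c2; apply/eqP; rewrite -sqrf_eq0 eq_le c2 sqr_ge0.
Qed.

End sub_sigma_algebra.

(** * Total boundedness and the Kronecker algebra *)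

Section totally_bounded.
Variables (R : realType) (G : Type).
Implicit Types dist : G -> G -> R.

(* Total boundedness of a G-indexed family for the pseudo-distance dist,
   phrased with finite colourings of G so that no net has to be chosen. *)
Definition tot_bounded dist := forall e, 0 < e ->
  exists (J : finType) (c : G -> J), forall g h, c g = c h -> dist g h < e.

Lemma tot_bounded0 dist : (forall g h, dist g h <= 0) -> tot_bounded dist.
Proof.
move=> d0 e e0; exists unit, (fun=> tt) => g h _.
exact: le_lt_trans (d0 g h) e0.
Qed.

Lemma tot_bounded_le d1 d2 C : 0 <= C -> tot_bounded d1 ->
  (forall g h, d2 g h <= C * d1 g h) -> tot_bounded d2.
Proof.
move=> C0 t1 d21 e e0; have C1 : 0 < C + 1 by rewrite ltr_wpDl.
have [J [c hc]] := t1 _ (divr_gt0 e0 C1).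
exists J, c => g h /hc; rewrite ltr_pdivlMr// => h1.
have [d0|d0] := ltP (d1 g h) 0.
  apply: le_lt_trans (d21 g h) _; apply: le_lt_trans e0.
  by rewrite mulr_ge0_le0// ltW.
by apply: le_lt_trans (d21 g h) _; rewrite mulrDr mulr1 mulrC in h1; lra.
Qed.

Lemma tot_bounded_add d1 d2 d3 : tot_bounded d1 -> tot_bounded d2 ->
  (forall g h, d3 g h <= d1 g h + d2 g h) -> tot_bounded d3.
Proof.
move=> t1 t2 d3le e e0; have e2 : 0 < e / 2 by rewrite divr_gt0.
have [J1 [c1 h1]] := t1 _ e2; have [J2 [c2 h2]] := t2 _ e2.
exists (J1 * J2)%type, (fun g => (c1 g, c2 g)) => g h [/h1 a /h2 b].
by apply: le_lt_trans (d3le g h) _; lra.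
Qed.

Lemma tot_bounded_sum (I : finType) (d : I -> G -> G -> R) :
  (forall i, tot_bounded (d i)) -> tot_bounded (fun g h => \sum_i d i g h).
Proof.
move=> td; elim: (index_enum I) => [|i r IH].
  by apply: tot_bounded0 => g h; rewrite big_nil.
by apply: tot_bounded_add (td i) IH _ => g h; rewrite big_cons.
Qed.

Lemma tot_bounded_approx d1 :
  (forall e, 0 < e -> exists d2, tot_bounded d2 /\
    forall g h, d1 g h <= d2 g h + e) -> tot_bounded d1.
Proof.
move=> ap e e0; have e2 : 0 < e / 2 by rewrite divr_gt0.
have [d2 [t2 d12]] := ap _ e2; have [J [c hc]] := t2 _ e2.
by exists J, c => g h /hc; have := d12 g h; lra.
Qed.

(** The colour of g is the bin of width e containing a g + M; two values in one bin differ by less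
    than e. *)
Lemma tot_bounded_real (a : G -> R) M : (forall g, `|a g| <= M) ->
  tot_bounded (fun g h => `|a g - a h|).
Proof.
move=> aM e e0.
pose N := (Num.truncn ((2 * M + 1) / e)).+1.
have N0 : (2 * M + 1) / e < N%:R by exact: truncnS_gt.
pose b g := Num.truncn ((a g + M) / e).
have aM' g : 0 <= (a g + M) / e.
  by apply: divr_ge0; [have := aM g; rewrite ler_norml; lra|exact: ltW].
have bN g : (b g < N)%N.
  rewrite -(ltr_nat R); apply: le_lt_trans (_ : (a g + M) / e < _).
    by rewrite truncn_le.
  apply: le_lt_trans N0; rewrite ler_pM2r ?invr_gt0//.
  by have := aM g; rewrite ler_norml; lra.
exists 'I_N, (fun g => Ordinal (bN g)) => g h [bgh].
have hg : (b g)%:R <= (a g + M) / e by rewrite truncn_le.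
have hh : (b h)%:R <= (a h + M) / e by rewrite truncn_le.
have hg' := truncnS_gt ((a g + M) / e); have hh' := truncnS_gt ((a h + M) / e).
rewrite -/(b g) in hg'; rewrite -/(b h) in hh'.
rewrite bgh in hg hg'.
rewrite -natr1 in hg' hh'.
rewrite ltr_pdivrMr// in hg'; rewrite ltr_pdivrMr// in hh'.
rewrite ler_pdivlMr// in hg; rewrite ler_pdivlMr// in hh.
by rewrite ltr_norml; lra.
Qed.

End totally_bounded.

(** * Translates of functions and the sigma-algebra of sets with precompact orbit *)

Section action.
Context d (T : measurableType d) (R : realType).
Variable P : {measure set T -> \bar R}.
Hypothesis P1 : P setT = 1%E.

Lemma mean_preserved (u : T -> T) f : measurable_fun setT u ->
  (forall B, measurable B -> P (u @^-1` B) = P B) ->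
  bmf f -> mean P (fun x => f (u x)) = mean P f.
Proof.
move=> mu Pu bf; rewrite /mean /Rintegral; congr fine.
rewrite (_ : (\int[P]_x (f x)%:E)%E = (\int[pushforward P u]_x (f x)%:E)%E).
  rewrite integral_pushforward//; first exact/measurable_EFinP/(bf.1).
  rewrite preimage_setT; apply: bmf_integrable => //; exact: bmf_comp.
by apply: eq_measure_integral => B mB _; rewrite -(Pu B mB).
Qed.

Lemma mean_bigcup_approx (F : nat -> set T) : (forall n, measurable (F n)) ->
  nondecreasing_seq F -> forall e, 0 < e ->
  exists N, mean P (fun x => \1_(\bigcup_n F n) x - \1_(F N) x) < e.
Proof.
move=> mF ndF e e0; have mU : measurable (\bigcup_n F n) by exact: bigcupT_measurable.
have fP B : measurable B -> P B \is a fin_num.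
  move=> mB; rewrite ge0_fin_numE//; apply: (@le_lt_trans _ _ (P setT)).
    by apply: le_measure; rewrite ?inE.
  by rewrite P1 ltry.
have /fine_cvgP[_ /cvgrPdist_lt /(_ e e0) [N _ /(_ N (leqnn N))]] :
    (P \o F) n @[n --> \oo] --> (fine (P (\bigcup_n F n)))%:E.
  by rewrite fineK ?fP//; exact: nondecreasing_cvg_mu.
move=> /= h; exists N.
rewrite meanB ?mean_indic//; [|exact: bmf_indic..].
exact: le_lt_trans (ler_norm _) h.
Qed.

Variables (G : Type) (mul : G -> G -> G) (act : G -> T -> T).
Hypothesis actM : forall g h x, act (mul g h) x = act g (act h x).
Hypothesis act_meas : forall g, measurable_fun setT (act g).
Hypothesis act_pres : forall g B, measurable B -> P (act g @^-1` B) = P B.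

Definition orbit_dist (f : T -> R) (g h : G) :=
  mean P (fun x => `|f (act g x) - f (act h x)|).

(** The Kronecker algebra with L1 distances and finite colourings; [kroneckerE] identifies it with
    [kronecker]. *)
Definition kron (B : set T) := measurable B /\ tot_bounded (orbit_dist \1_B).

Lemma mean_act (f : T -> R) g : bmf f -> mean P (fun x => f (act g x)) = mean P f.
Proof. by move=> bf; apply: mean_preserved => // B; exact: act_pres. Qed.

Lemma bmf_act (f : T -> R) g : bmf f -> bmf (fun x => f (act g x)).
Proof. exact: bmf_comp. Qed.

(** Replacing f by f' is paid for once at each of the two translates, and by invariance each time
    costs the same L1 distance. *)
Lemma orbit_dist_approx (f f' : T -> R) g h : bmf f -> bmf f' ->
  orbit_dist f g h <= orbit_dist f' g h + 2 * mean P (fun x => `|f x - f' x|).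
Proof.
move=> bf bf'; pose D x := `|f x - f' x|.
have bD : bmf D by rewrite /D; bm.
have bfa (u : T -> R) k : bmf u -> bmf (fun x => u (act k x)) by exact: bmf_act.
have b1 := bfa _ g bf; have b2 := bfa _ h bf; have b3 := bfa _ g bf'.
have b4 := bfa _ h bf'; have b5 := bfa _ g bD; have b6 := bfa _ h bD.
rewrite mulr_natl mulr2n -{1}(mean_act g bD) -(mean_act h bD).
rewrite -!meanD//; [|by bm..]; apply: le_mean => //; [by bm..|move=> x].
rewrite /D; set a := f _; set b := f _; set a' := f' _; set b' := f' _.
have -> : a - b = (a' - b') + (a - a') - (b - b') by ring.
apply: le_trans (ler_normB _ _) _; rewrite [leRHS]addrA lerD2r.
exact: ler_normD.
Qed.

Lemma tot_bounded_orbit_approx (f : T -> R) : bmf f ->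
  (forall e, 0 < e -> exists f', [/\ bmf f', tot_bounded (orbit_dist f') &
    mean P (fun x => `|f x - f' x|) < e]) -> tot_bounded (orbit_dist f).
Proof.
move=> bf ap; apply: tot_bounded_approx => e e0.
have e2 : 0 < e / 2 by rewrite divr_gt0.
have [f' [bf' tf' ff']] := ap _ e2.
exists (orbit_dist f'); split => // g h.
by have := orbit_dist_approx g h bf bf'; lra.
Qed.

Lemma kron0 : kron set0.
Proof.
split => //; apply: tot_bounded0 => g h; rewrite /orbit_dist.
by rewrite (@eq_mean _ _ _ _ _ (fun=> 0)) ?mean_cst// => x; rewrite indic0 subrr normr0.
Qed.

Lemma kronC B : kron B -> kron (~` B).
Proof.
move=> [mB tB]; split; first exact: measurableC.
apply: (tot_bounded_le ler01 tB) => g h; rewrite mul1r /orbit_dist.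
rewrite le_eqVlt; apply/orP; left; apply/eqP; apply: eq_mean => x.
by rewrite !indicE !in_setC; do 2 case: (_ \in B);
  rewrite /= ?subrr ?subr0 ?sub0r ?normrN.
Qed.

Lemma kronU A B : kron A -> kron B -> kron (A `|` B).
Proof.
move=> [mA tA] [mB tB]; split; first exact: measurableU.
apply: (tot_bounded_add tA tB) => g h; rewrite /orbit_dist.
have bA k : bmf (fun x => \1_A (act k x) : R) by apply: bmf_act; exact: bmf_indic.
have bB k : bmf (fun x => \1_B (act k x) : R) by apply: bmf_act; exact: bmf_indic.
have bAB k : bmf (fun x => \1_(A `|` B) (act k x) : R).
  by apply: bmf_act; apply: bmf_indic; exact: measurableU.
rewrite -meanD//; [|by bm..]; apply: le_mean => //; [by bm..|move=> x].
rewrite !indicE !in_setU.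
by do 4 case: (_ \in _); rewrite /= ?subrr ?subr0 ?sub0r ?normrN ?normr1 ?normr0; lra.
Qed.

(** The finite unions lie in the algebra and approximate the countable union in L1; total
    boundedness of orbits survives L1 approximation. *)
Lemma kron_bigcup (F : nat -> set T) : (forall n, kron (F n)) ->
  kron (\bigcup_n F n).
Proof.
move=> kF; pose U n := \big[setU/set0]_(i < n.+1) F i.
have kU n : kron (U n).
  rewrite /U; elim: n.+1 => [|m IH]; first by rewrite big_ord0; exact: kron0.
  by rewrite big_ord_recr; exact: kronU.
have ndU : nondecreasing_seq U.
  move=> m n mn; apply/subsetPset; rewrite /U -!bigcup_mkord => x [i /= im Fx].
  by exists i => //=; rewrite (leq_trans im).
have UE : \bigcup_n U n = \bigcup_n F n by exact: bigcup_bigsetU_bigcup.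
split; first by apply: bigcupT_measurable => n; case: (kF n).
have mU n : measurable (U n) by case: (kU n).
have bF : bmf (\1_(\bigcup_n F n) : T -> R).
  by apply: bmf_indic; apply: bigcupT_measurable => n; case: (kF n).
apply: tot_bounded_orbit_approx => // e e0.
have [N hN] := mean_bigcup_approx mU ndU e0.
exists (\1_(U N)); split; [exact: bmf_indic|exact: (kU N).2|].
rewrite UE in hN.
rewrite (@eq_mean _ _ _ _ _ (fun x => \1_(\bigcup_n F n) x - \1_(U N) x))//.
move=> x; rewrite ger0_norm// subr_ge0 !indicE ler_nat.
have [UN|_] := boolP (x \in U N); last by case: (x \in _).
suff -> : x \in \bigcup_n F n by [].
by apply/mem_set; rewrite -UE; exists N => //; exact/set_mem.
Qed.

Lemma kron_sigma_algebra : sigma_algebra setT kron.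
Proof.
split; [exact: kron0|by move=> A /kronC; rewrite setTD|exact: kron_bigcup].
Qed.

(** Translating B only reindexes its orbit by left multiplication with g, so the colouring of B is
    composed with that multiplication. *)
Lemma kron_act g B : kron B -> kron (act g @^-1` B).
Proof.
move=> [mB tB]; split.
  by rewrite -[X in measurable X]setTI; exact: act_meas.
move=> e /tB[J [c hc]]; exists J, (fun h => c (mul g h)) => h k /hc.
rewrite /orbit_dist; congr (_ < _); apply: eq_mean => x.
by rewrite !actM.
Qed.

(* Level sets are handled by the ramps min 1 (max 0 (n (v - c))), which are
   Lipschitz and increase to the indicator of c < v. *)
Lemma kron_gt (v : T -> R) c : bmf v -> tot_bounded (orbit_dist v) ->
  kron [set x | c < v x].
Proof.
move=> bv tv.
have mgt a : measurable [set x | a < v x].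
  have := bv.1 measurableT _ (measurable_itv `]a, +oo[); rewrite setTI.
  by congr measurable; apply/seteqP; split => x /=; rewrite in_itv/= andbT.
split => //; have bI : bmf (\1_[set x | c < v x] : T -> R) by exact: bmf_indic.
apply: tot_bounded_orbit_approx => // e e0.
pose U n := [set x | c + n.+1%:R^-1 < v x].
have ndU : nondecreasing_seq U.
  move=> m n mn; apply/subsetPset => x /=; apply: le_lt_trans.
  by rewrite lerD2l lef_pV2 ?posrE// ler_nat.
have UE : \bigcup_n U n = [set x | c < v x].
  apply/seteqP; split => [x [n _ /=]|x /= cv].
    by apply: le_lt_trans; rewrite lerDl invr_ge0.
  have vc : 0 < v x - c by rewrite subr_gt0.
  have /ltr_add_invr[n hn] : c < v x by [].
  by exists n.
have [N] := mean_bigcup_approx (fun n => mgt _) ndU e0; rewrite UE => hN.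
pose r x := Num.min 1 (Num.max 0 (N.+1%:R * (v x - c))).
have br : bmf r.
  by apply: bmf_min; [exact: bmf_cst|apply: bmf_max; [exact: bmf_cst|bm]].
exists r; split => //.
  (* The ramp is Lipschitz in v with constant N + 1. *)
  apply: (@tot_bounded_le _ _ _ _ N.+1%:R _ tv) => // g h.
  have b1 := bmf_act g bv; have b2 := bmf_act h bv.
  have b3 := bmf_act g br; have b4 := bmf_act h br.
  rewrite /orbit_dist -meanZ//; [|by bm]; apply: le_mean => //; [by bm..|move=> x].
  rewrite -[X in X * _](@ger0_norm _ N.+1%:R)// -normrM /r.
  set a := v _; set b := v _; set n := N.+1%:R.
  have -> : n * (a - b) = n * (a - c) - n * (b - c) by ring.
  set s := n * (a - c); set t := n * (b - c).
  rewrite ler_norml.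
  have := ler_norm (s - t); have := ler_norm (- (s - t)); rewrite normrN.
  rewrite /Num.min /Num.max.
  by case: (ltP 0 s) => ?; case: (ltP 0 t) => ?; do 2 case: ltP => ?;
    move=> *; apply/andP; split; lra.
(* The ramp agrees with the indicator outside the set where c < v <= c + 1/(N+1), and there it
   differs from it by at most 1. *)
apply: le_lt_trans hN; apply: le_mean => //; [by bm| |].
  by apply: bmfB => //; exact: bmf_indic.
move=> x; rewrite !indic_bool /r.
have n0 : 0 < N.+1%:R :> R by [].
have [h1|h1] := ltP (c + N.+1%:R^-1) (v x).
  have cv : c < v x by apply: le_lt_trans h1; rewrite lerDl invr_ge0.
  rewrite cv subrr max_r; last by rewrite mulr_ge0// subr_ge0 ltW.
  rewrite min_l ?subrr ?normr0//.
  by rewrite -ler_pdivrMl// mulr1 lerBrDl ltW.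
rewrite subr0; have [h2|h2] := ltP c (v x).
  have z0 : 0 <= N.+1%:R * (v x - c) by rewrite mulr_ge0// subr_ge0 ltW.
  have z1 : N.+1%:R * (v x - c) <= 1 by rewrite -ler_pdivlMl// mulr1 lerBlDl.
  by rewrite max_r// min_r// ger0_norm ?subr_ge0// gerBl.
by rewrite max_l ?mulr_ge0_le0 ?subr_le0// min_r// subrr normr0.
Qed.

End action.

(** * The weak mixing property of functions orthogonal to the Kronecker algebra *)

Section kernels.
Context d (T : measurableType d) (R : realType).
Variable P : {measure set T -> \bar R}.
Hypothesis P1 : P setT = 1%E.
Implicit Types (Q S : T -> T -> R) (f h : T -> R).

(** The algebraic tensor square of the bounded measurable functions. Properties of kernels are
    proved by induction on this predicate, starting from products. *)
Inductive tens : (T -> T -> R) -> Prop :=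
| tens_prod a b : bmf a -> bmf b -> tens (fun x y => a x * b y)
| tensD Q S : tens Q -> tens S -> tens (fun x y => Q x y + S x y).

Lemma eq_tens Q S : tens Q -> (forall x y, S x y = Q x y) -> tens S.
Proof. by move=> tQ QS; have -> : S = Q by apply/funext => x; exact/funext. Qed.

Lemma tensM Q S : tens Q -> tens S -> tens (fun x y => Q x y * S x y).
Proof.
move=> tQ tS; elim: tQ => [a b ba bb|Q1 Q2 _ IH1 _ IH2]; last first.
  by apply: eq_tens (tensD IH1 IH2) _ => x y; rewrite mulrDl.
elim: tS => [a' b' ba' bb'|S1 S2 _ IH1 _ IH2]; last first.
  by apply: eq_tens (tensD IH1 IH2) _ => x y; rewrite mulrDr.
by apply: eq_tens (tens_prod (bmfM ba ba') (bmfM bb bb')) _ => x y; rewrite mulrACA.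
Qed.

Lemma tensZ c Q : tens Q -> tens (fun x y => c * Q x y).
Proof.
move=> tQ; apply: eq_tens (tensM (tens_prod (bmf_cst _ c) (bmf_cst _ 1)) tQ) _.
by move=> x y; rewrite mulr1.
Qed.

Lemma tensB Q S : tens Q -> tens S -> tens (fun x y => Q x y - S x y).
Proof.
move=> tQ tS; apply: eq_tens (tensD tQ (tensZ (-1) tS)) _ => x y.
by rewrite mulN1r.
Qed.

Lemma tens_sum (I : finType) (Q : I -> T -> T -> R) : (forall i, tens (Q i)) ->
  tens (fun x y => \sum_i Q i x y).
Proof.
move=> tQ; elim: (index_enum I) => [|i s IH].
  apply: eq_tens (tens_prod (bmf_cst _ 0) (bmf_cst _ 0)) _ => x y.
  by rewrite big_nil mulr0.
by apply: eq_tens (tensD (tQ i) IH) _ => x y; rewrite big_cons.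
Qed.

Lemma tens_section Q x : tens Q -> bmf (Q x).
Proof.
by elim=> [a b ba bb|Q1 Q2 _ IH1 _ IH2]; [apply: bmfM => //; exact: bmf_cst|exact: bmfD].
Qed.

Lemma tens_marginal Q : tens Q -> bmf (fun x => mean P (Q x)).
Proof.
elim=> [a b ba bb|Q1 Q2 t1 IH1 t2 IH2].
  rewrite (_ : (fun _ => _) = fun x => a x * mean P b); first by bm.
  by apply/funext => x; rewrite meanZ.
rewrite (_ : (fun _ => _) = fun x => mean P (Q1 x) + mean P (Q2 x)); first by bm.
by apply/funext => x; rewrite meanD//; exact: tens_section.
Qed.

Definition mean2 Q := mean P (fun x => mean P (Q x)).

Lemma eq_mean2 Q S : (forall x y, Q x y = S x y) -> mean2 Q = mean2 S.
Proof. by move=> QS; apply: eq_mean => x; exact: eq_mean. Qed.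

Lemma mean2D Q S : tens Q -> tens S ->
  mean2 (fun x y => Q x y + S x y) = mean2 Q + mean2 S.
Proof.
move=> tQ tS; rewrite /mean2 -meanD//; [|exact: tens_marginal..].
by apply: eq_mean => x; rewrite meanD//; exact: tens_section.
Qed.

Lemma mean2Z c Q : tens Q -> mean2 (fun x y => c * Q x y) = c * mean2 Q.
Proof.
move=> tQ; rewrite /mean2 -meanZ//; last exact: tens_marginal.
by apply: eq_mean => x; rewrite meanZ//; exact: tens_section.
Qed.

Lemma mean2_ge0 Q : (forall x y, 0 <= Q x y) -> 0 <= mean2 Q.
Proof. by move=> Q0; apply: mean_ge0 => x; exact: mean_ge0. Qed.

Definition sqr2 Q := mean2 (fun x y => Q x y ^+ 2).

Lemma tens_sqr Q : tens Q -> tens (fun x y => Q x y ^+ 2).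
Proof. by move=> tQ; apply: eq_tens (tensM tQ tQ) _ => x y; rewrite expr2. Qed.

Lemma sqr2_parallelogram Q S : tens Q -> tens S ->
  sqr2 (fun x y => Q x y - S x y) =
  2 * sqr2 Q + 2 * sqr2 S - 4 * sqr2 (fun x y => 2^-1 * (Q x y + S x y)).
Proof.
move=> tQ tS; rewrite /sqr2 (@eq_mean2 _ (fun x y =>
   (2 * Q x y ^+ 2 + 2 * S x y ^+ 2) + (-4) * (2^-1 * (Q x y + S x y)) ^+ 2)).
  have t1 := tensZ 2 (tens_sqr tQ); have t2 := tensZ 2 (tens_sqr tS).
  have t3 := tens_sqr (tensZ 2^-1 (tensD tQ tS)).
  rewrite mean2D//; [|exact: tensD|exact: tensZ].
  rewrite mean2D// !mean2Z//; [|exact: tens_sqr..].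
  by rewrite mulNr.
by move=> x y; field.
Qed.

(** The integral operator with kernel Q, applied to h. *)
Definition op Q h x := mean P (fun y => Q x y * h y).

Lemma tens_op Q h : tens Q -> bmf h -> tens (fun x y => Q x y * h y).
Proof.
move=> tQ bh; apply: eq_tens (tensM tQ (tens_prod (bmf_cst _ 1) bh)) _ => x y.
by rewrite mul1r.
Qed.

Lemma bmf_op Q h : tens Q -> bmf h -> bmf (op Q h).
Proof. by move=> tQ bh; exact/tens_marginal/tens_op. Qed.

Lemma opD Q S h x : tens Q -> tens S -> bmf h ->
  op (fun x y => Q x y + S x y) h x = op Q h x + op S h x.
Proof.
move=> tQ tS bh; rewrite /op -meanD//;
  [|exact: (tens_section x (tens_op _ bh))..].
by apply: eq_mean => y; rewrite mulrDl.
Qed.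

Lemma opZ c Q h x : tens Q -> bmf h ->
  op (fun x y => c * Q x y) h x = c * op Q h x.
Proof.
move=> tQ bh; rewrite /op -meanZ//; last exact: (tens_section x (tens_op tQ bh)).
by apply: eq_mean => y; rewrite mulrA.
Qed.

Lemma opB Q S h x : tens Q -> tens S -> bmf h ->
  op (fun x y => Q x y - S x y) h x = op Q h x - op S h x.
Proof.
move=> tQ tS bh; rewrite /op -meanB//;
  [|exact: (tens_section x (tens_op _ bh))..].
by apply: eq_mean => y; rewrite mulrBl.
Qed.

Lemma op_prod a b h x : bmf b -> bmf h ->
  op (fun x y => a x * b y) h x = a x * mean P (fun y => b y * h y).
Proof.
move=> bb bh; rewrite /op -meanZ//; last by bm.
by apply: eq_mean => y; rewrite mulrA.
Qed.

(** The Hilbert-Schmidt bound: Cauchy-Schwarz in y for each fixed x, then integration in x. *)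
Lemma mean_op_sqr_le Q h : tens Q -> bmf h ->
  mean P (fun x => op Q h x ^+ 2) <= sqr2 Q * mean P (fun x => h x ^+ 2).
Proof.
move=> tQ bh; have bo := bmf_op tQ bh.
have bq : bmf (fun x => mean P (fun y => Q x y ^+ 2)).
  exact: tens_marginal (tens_sqr tQ).
rewrite /sqr2 /mean2 -meanZr//; apply: le_mean => //; [by bm..|move=> x].
by apply: cauchy_schwarz_mean => //; exact: tens_section.
Qed.

Lemma mean_norm_op_le Q h e M : tens Q -> bmf h -> (forall x, `|h x| <= M) ->
  0 <= e -> sqr2 Q <= e ^+ 2 -> mean P (fun x => `|op Q h x|) <= e * M.
Proof.
move=> tQ bh hM e0 Qe.
have M0 : 0 <= M by exact: le_trans (normr_ge0 _) (hM point).
apply: mean_le_sqrt => //; [exact: bmf_op| |exact: mulr_ge0].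
apply: le_trans (mean_op_sqr_le tQ bh) _; rewrite exprMn; apply: ler_pM => //.
- by apply: mean2_ge0 => x y; exact: sqr_ge0.
- by apply: mean_ge0 => x; exact: sqr_ge0.
- rewrite -[leRHS](mean_cst P1); apply: le_mean => //; [by bm|exact: bmf_cst|].
  by move=> x; rewrite -[leLHS]real_normK ?num_real// lerXn2r ?nnegrE.
Qed.

Variables (G : Type) (act : G -> T -> T).
Hypothesis act_meas : forall g, measurable_fun setT (act g).
Hypothesis act_pres : forall g B, measurable B -> P (act g @^-1` B) = P B.

Lemma tens_act Q g : tens Q -> tens (fun x y => Q (act g x) (act g y)).
Proof.
elim=> [a b ba bb|Q1 Q2 _ IH1 _ IH2]; last exact: (tensD IH1 IH2).
exact: (tens_prod (bmf_comp (act_meas g) ba) (bmf_comp (act_meas g) bb)).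
Qed.

Lemma sqr2_act Q g : tens Q -> sqr2 (fun x y => Q (act g x) (act g y)) = sqr2 Q.
Proof.
move=> tQ; have tQ2 := tens_sqr tQ.
rewrite /sqr2 /mean2 -(mean_act P1 act_meas act_pres g (tens_marginal tQ2)).
apply: eq_mean => x; rewrite -[RHS](mean_act P1 act_meas act_pres g)//.
exact: (tens_section (act g x) tQ2).
Qed.

Lemma op_act Q h g x : tens Q -> bmf h ->
  op Q h (act g x) = op (fun x y => Q (act g x) (act g y)) (fun y => h (act g y)) x.
Proof.
move=> tQ bh; rewrite /op -[LHS](mean_act P1 act_meas act_pres g)//.
exact: (tens_section (act g x) (tens_op tQ bh)).
Qed.

(** The operator has finite rank: for a kernel a(x) b(y) the translate of h enters only through the
    bounded scalar [mean P (fun y => b y * h (act g y))]. *)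
Lemma tot_bounded_op Q h : tens Q -> bmf h ->
  tot_bounded (fun g g' => mean P (fun x =>
    `|op Q (fun y => h (act g y)) x - op Q (fun y => h (act g' y)) x|)).
Proof.
move=> tQ bh; have bha g : bmf (fun y => h (act g y)) by exact: bmf_comp.
elim: tQ => [a b ba bb|Q1 Q2 t1 IH1 t2 IH2]; last first.
  apply: (tot_bounded_add IH1 IH2) => g g'.
  have bo S k : tens S -> bmf (op S (fun y => h (act k y))).
    by move=> tS; exact: bmf_op.
  have b1 := bo _ g t1; have b2 := bo _ g' t1.
  have b3 := bo _ g t2; have b4 := bo _ g' t2.
  have b5 := bo _ g (tensD t1 t2); have b6 := bo _ g' (tensD t1 t2).
  rewrite -meanD//; [|by bm..]; apply: le_mean => //; [by bm..|move=> x].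
  rewrite !opD//; set p := op _ _ _; set q := op _ _ _; set r := op _ _ _.
  set s := op _ _ _; have -> : p + q - (r + s) = (p - r) + (q - s) by ring.
  exact: ler_normD.
have [bM [M hM]] := bh; have [mb [N hN]] := bb.
pose c g := mean P (fun y => b y * h (act g y)).
have cM g : `|c g| <= N * M.
  have bbh : bmf (fun y => b y * h (act g y)) by bm.
  apply: le_trans (norm_mean P1 bbh) _.
  rewrite -[leRHS](mean_cst P1); apply: le_mean => //; [by bm|exact: bmf_cst|].
  by move=> x; rewrite normrM ler_pM.
have [ma [A hA]] := ba.
have A0 : 0 <= A by exact: le_trans (normr_ge0 _) (hA point).
apply: (tot_bounded_le A0 (tot_bounded_real cM)) => g g'.
rewrite -[leRHS](mean_cst P1); apply: le_mean => //; [|exact: bmf_cst|].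
  apply: bmf_norm; apply: bmfB; apply: bmf_op => //; exact: tens_prod.
move=> x; rewrite !op_prod// -mulrBr normrM; apply: ler_pM => //.
Qed.

End kernels.

Section weak_mixing.
Context d (T : measurableType d) (R : realType).
Variable P : {measure set T -> \bar R}.
Hypothesis P1 : P setT = 1%E.
Variables (G : Type) (mul : G -> G -> G) (inv : G -> G) (act : G -> T -> T).
Hypothesis actM : forall g h x, act (mul g h) x = act g (act h x).
Hypothesis actV : forall g x, act g (act (inv g) x) = x.
Hypothesis act_meas : forall g, measurable_fun setT (act g).
Hypothesis act_pres : forall g B, measurable B -> P (act g @^-1` B) = P B.
Variables (I : finType) (f : I -> T -> R).
Hypothesis bf : forall i, bmf (f i).
Hypothesis f_orth : forall i B, kron P act B -> mean P (fun x => \1_B x * f i x) = 0.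

Definition orbit_kernel g x y : R := \sum_i f i (act g x) * f i (act g y).

(* Closure under midpoints is all the parallelogram law needs. *)
Inductive midhull : (T -> T -> R) -> Prop :=
| midhull_orbit g : midhull (orbit_kernel g)
| midhull_mid Q S : midhull Q -> midhull S ->
    midhull (fun x y => 2^-1 * (Q x y + S x y)).

Lemma midhull_tens Q : midhull Q -> tens Q.
Proof.
elim=> [g|Q1 Q2 _ t1 _ t2]; last exact: (tensZ 2^-1 (tensD t1 t2)).
by apply: tens_sum => i; apply: tens_prod; exact: bmf_comp.
Qed.

(** Moving both variables by g sends the orbit kernel of h to that of [mul h g], and midpoints to
    midpoints. *)
Lemma midhull_act Q g : midhull Q -> midhull (fun x y => Q (act g x) (act g y)).
Proof.
elim=> [h|Q1 Q2 _ t1 _ t2]; last exact: (midhull_mid t1 t2).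
suff -> : (fun x y => orbit_kernel h (act g x) (act g y)) = orbit_kernel (mul h g).
  exact: midhull_orbit.
apply/funext => x; apply/funext => y; rewrite /orbit_kernel.
by under eq_bigr do rewrite -!actM.
Qed.

Lemma midhull_bounded : exists M, forall Q, midhull Q -> forall x y, `|Q x y| <= M.
Proof.
have /choice[N hN] i : exists N, forall x, `|f i x| <= N by exact: (bf i).2.
exists (\sum_i N i * N i) => Q; elim=> [g|Q1 Q2 _ IH1 _ IH2] x y.
  apply: le_trans (ler_norm_sum _ _ _) _; apply: ler_sum => i _.
  by rewrite normrM ler_pM.
rewrite normrM ger0_norm ?invr_ge0// ler_pdivrMl//.
apply: le_trans (ler_normD _ _) _; rewrite mulr_natl mulr2n.
exact: lerD (IH1 x y) (IH2 x y).
Qed.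

(** The image of h under an orbit kernel is a linear combination of translates of the f i, each of
    which is orthogonal to the translation-invariant algebra. *)
Lemma midhull_orth Q h B : midhull Q -> bmf h -> kron P act B ->
  mean P (fun x => \1_B x * op P Q h x) = 0.
Proof.
move=> CQ bh KB; have bB : bmf (\1_B : T -> R) by apply/bmf_indic; case: KB.
elim: CQ => [g|Q1 Q2 C1 IH1 C2 IH2].
  have bfa i : bmf (fun x => f i (act g x)) by exact: bmf_comp.
  pose c i := mean P (fun y => f i (act g y) * h y).
  rewrite (@eq_mean _ _ _ _ _ (fun x => \sum_i c i * (\1_B x * f i (act g x)))).
    rewrite mean_sum//; last by bm.
    rewrite big1// => i _; rewrite meanZ//; last by bm.
    have bp : bmf (fun x => \1_B x * f i (act g x)) by bm.
    (* Substituting g^-1 x for x moves the translation from f i to B, and the translated set is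
       again in the algebra. *)
    rewrite -(mean_act P1 act_meas act_pres (inv g) bp).
    under eq_mean do rewrite actV.
    by have := f_orth i (kron_act actM act_meas (inv g) KB) => ->; rewrite mulr0.
  move=> x; rewrite /op /orbit_kernel.
  rewrite (@eq_mean _ _ _ _ _ (fun y => \sum_i f i (act g x) * (f i (act g y) * h y))).
    rewrite mean_sum//; last by bm.
    rewrite mulr_sumr; apply: eq_bigr => i _; rewrite meanZ//; last by bm.
    by rewrite -/(c i); ring.
  by move=> y; rewrite mulr_suml; apply: eq_bigr => i _; rewrite mulrA.
have t1 := midhull_tens C1; have t2 := midhull_tens C2.
have b1 := bmf_op P1 t1 bh; have b2 := bmf_op P1 t2 bh.
rewrite (@eq_mean _ _ _ _ _
  (fun x => 2^-1 * (\1_B x * op P Q1 h x + \1_B x * op P Q2 h x))).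
  by rewrite meanZ ?meanD ?IH1 ?IH2 ?addr0 ?mulr0//; bm.
by move=> x; rewrite opZ ?opD//; [ring|exact: tensD].
Qed.

Section minimizer.
Variables (D : R) (Q : nat -> T -> T -> R).
Hypothesis D_le : forall S, midhull S -> D <= sqr2 P S.
Hypothesis CQ : forall n, midhull (Q n).
Hypothesis QD : forall n, sqr2 P (Q n) <= D + 4^-1 ^+ n.
Variable h : T -> R.
Hypothesis bh : bmf h.

Let pow_ge0 n : 0 <= (2^-1 : R) ^+ n.
Proof. by rewrite exprn_ge0// invr_ge0. Qed.

(** Two near-minimizers are close because their midpoint, still in the hull, has squared norm at
    least D. *)
Lemma midhull_sqr2_sub S S' n : midhull S -> midhull S' ->
  sqr2 P S <= D + 4^-1 ^+ n -> sqr2 P S' <= D + 4^-1 ^+ n ->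
  sqr2 P (fun x y => S x y - S' x y) <= (2 * 2^-1 ^+ n) ^+ 2.
Proof.
move=> C1 C2 h1 h2; rewrite sqr2_parallelogram//; [|exact: midhull_tens..].
move: (D_le (midhull_mid C1 C2)) h1 h2; rewrite exprMn -exprV4.
move: (sqr2 P S) (sqr2 P S') (sqr2 P _) (_ ^+ n) => a b c X Dc aX bX.
by lra.
Qed.

(** The functions [op P (Q n) h] converge in L1 at a geometric rate to a function w that is both
    measurable for and orthogonal to the Kronecker algebra, hence zero almost everywhere. *)
Lemma minimizer_op_small : exists C, forall n,
  mean P (fun x => op P (Q n) h x * h x) <= C * 2^-1 ^+ n.
Proof.
have [mh [M hM]] := bh.
have M0 : 0 <= M by exact: le_trans (normr_ge0 _) (hM point).
have tQ n : tens (Q n) by exact: midhull_tens.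
have [N hN] := midhull_bounded.
pose v n := op P (Q n) h.
have bv n : bmf (v n) by exact: bmf_op.
have vM n x : `|v n x| <= N * M.
  have bx : bmf (fun y => Q n x y * h y) by exact: (tens_section x (tens_op (tQ n) bh)).
  apply: le_trans (norm_mean P1 bx) _; rewrite -[leRHS](mean_cst P1).
  apply: le_mean => //; [by bm|exact: bmf_cst|move=> y].
  by rewrite normrM ler_pM// hN.
have vC n : mean P (fun x => `|v n.+1 x - v n x|) <= 2 * M * 2^-1 ^+ n.
  rewrite (@eq_mean _ _ _ _ _
      (fun x => `|op P (fun x y => Q n.+1 x y - Q n x y) h x|)); last first.
    by move=> x; rewrite opB.
  rewrite mulrAC; apply: mean_norm_op_le => //; [exact: tensB|].
  apply: midhull_sqr2_sub => //; apply: le_trans (QD n.+1) _; rewrite lerD2l.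
  by rewrite !exprV4 lerXn2r ?nnegrE// exprS ler_piMl// invf_le1// ler1n.
pose w := sup_limit v.
have bw : bmf w by apply: (@bmf_sup_limit _ _ _ v (N * M)) => // n; exact: (bv n).1.
have vw n := @mean_sup_limit_le _ T R P P1 v (N * M) _ (fun n => (bv n).1) vM vC n.
rewrite -/w in vw.
have tw : tot_bounded (orbit_dist P act w).
  apply: tot_bounded_approx => e e0.
  (* Replacing w by v n at two translates costs 8 M 2^-n; replacing Q n by its translates, twice,
     costs 4 M 2^-n. *)
  have [n hn] := geometric_small (12 * M) e0.
  exists (fun g g' => mean P (fun x => `|op P (Q n) (fun y => h (act g y)) x -
      op P (Q n) (fun y => h (act g' y)) x|)).
  split; first exact: tot_bounded_op.
  move=> g g'; apply: le_trans (orbit_dist_approx P1 act_meas act_pres g g' bw (bv n)) _.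
  have bha k : bmf (fun y => h (act k y)) by exact: bmf_comp.
  have bo k : bmf (op P (Q n) (fun y => h (act k y))) by exact: bmf_op.
  have bva k : bmf (fun x => v n (act k x)) by exact: bmf_comp.
  (* Q n and its translate by k have the same norm, so both are near-minimizers and therefore close:
     this is the asymptotic invariance. *)
  have hk k : mean P (fun x => `|v n (act k x) - op P (Q n) (fun y => h (act k y)) x|)
      <= 2 * 2^-1 ^+ n * M.
    have tk := tens_act act_meas k (tQ n).
    rewrite (@eq_mean _ _ _ _ _ (fun x =>
      `|op P (fun x y => Q n (act k x) (act k y) - Q n x y) (fun y => h (act k y)) x|)).
      apply: mean_norm_op_le => //; [exact: tensB|].
      apply: midhull_sqr2_sub => //; first exact: midhull_act.
      by rewrite (sqr2_act P1 act_meas act_pres k (tQ n)).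

    by move=> x; rewrite opB// /v (op_act P1 act_meas act_pres).
  have tri : orbit_dist P act (v n) g g' <=
      mean P (fun x => `|op P (Q n) (fun y => h (act g y)) x -
      op P (Q n) (fun y => h (act g' y)) x|) + (2 * 2^-1 ^+ n * M + 2 * 2^-1 ^+ n * M).
    apply: le_trans (lerD (lexx _) (lerD (hk g) (hk g'))).
    have b1 := bo g; have b2 := bo g'; have b3 := bva g; have b4 := bva g'.
    rewrite -!meanD//; [|by bm..]; apply: le_mean => //; [by bm..|move=> x].
    set p := v n _; set q := v n _; set r := op _ _ _ _; set s := op _ _ _ _.
    have -> : p - q = (r - s) + (p - r) - (q - s) by ring.
    apply: le_trans (ler_normB _ _) _; rewrite [leRHS]addrA lerD2r.
    exact: ler_normD.
  have hvw : mean P (fun x => `|w x - v n x|) <= 2 * (2 * M) * 2^-1 ^+ n.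
    by under eq_mean do rewrite distrC.
  move: tri hvw hn; move: (orbit_dist _ _ _ _ _) (mean P _) (mean P _) (_ ^+ n).
  by move=> a b c p ab cp pe; lra.
have KwP : kron P act [set x | 0 < w x] by exact: kron_gt.
have KwN : kron P act [set x | w x < 0].
  have -> : [set x | w x < 0] = [set x | 0 < - w x].
    by apply/seteqP; split => x /=; rewrite oppr_gt0.
  apply: kron_gt => //; first by bm.
  apply: (tot_bounded_le ler01 tw) => g g'; rewrite mul1r /orbit_dist.
  rewrite le_eqVlt; apply/orP; left; apply/eqP; apply: eq_mean => x.
  by rewrite -opprD normrN.
have w0 : mean P (fun x => `|w x|) = 0.
  apply: (@mean_norm_eq0 _ _ _ _ P1 (kron P act)) => //; first by move=> B [].
  move=> B KB; have bB : bmf (\1_B : T -> R) by apply/bmf_indic; case: KB.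
  apply/eqP; rewrite -normr_le0.
  apply: (@le_of_le_add_geometric _ _ _ (2 * (2 * M))) => n.
  rewrite add0r; apply: le_trans (vw n).
  (* Subtracting v n is free, since v n is orthogonal to B. *)
  have -> : mean P (fun x => \1_B x * w x) = mean P (fun x => \1_B x * (w x - v n x)).
    under [RHS]eq_mean do rewrite mulrBr.
    by rewrite meanB//; [|by bm..]; rewrite midhull_orth// subr0.
  have bd : bmf (fun x => \1_B x * (w x - v n x)).
    by have := bv n => bvn; bm.
  apply: le_trans (norm_mean P1 bd) _; have bvn := bv n.
  apply: le_mean => //; [by bm..|move=> x].
  by rewrite normrM distrC; case: (indic_eq01 R B x) => ->;
    rewrite ?normr0 ?normr1 ?mul0r ?mul1r.
exists (2 * (2 * M) * M) => n; have bvn := bv n.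
apply: (@le_trans _ _ (mean P (fun x => M * `|v n x - w x| + M * `|w x|))).
  apply: le_mean => //; [by bm..|move=> x]; rewrite -mulrDr -/(v n x).
  apply: le_trans (ler_norm _) _; rewrite normrM mulrC ler_pM//.
  by rewrite -{1}(subrK (w x) (v n x)); exact: ler_normD.
rewrite meanD//; [|by bm..]; rewrite !meanZ//; [|by bm..].
rewrite w0 mulr0 addr0 (_ : 2 * (2 * M) * M * _ = M * (2 * (2 * M) * 2^-1 ^+ n)).
  exact: ler_wpM2l.
by ring.
Qed.

End minimizer.

(** A single g serves all pairs (i, j). If none did, [ell] would be at least e on every orbit
    kernel, whereas it tends to 0 along a minimizing sequence of the hull. *)
Lemma weak_mixing (J : finType) (h : J -> T -> R) (g0 : G) : (forall j, bmf (h j)) ->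
  forall e, 0 < e -> exists g,
  \sum_j \sum_i mean P (fun x => f i (act g x) * h j x) ^+ 2 < e.
Proof.
move=> bh e e0; apply: contrapT => /forallNP no.
have ge g : e <= \sum_j \sum_i mean P (fun x => f i (act g x) * h j x) ^+ 2.
  by rewrite leNgt; apply/negP; exact: no.
have [|S _|D [Q [Dle QD]]] := @minimizing_sequence R _ [set Q | midhull Q] (sqr2 P).
- by exists (orbit_kernel g0); exact: midhull_orbit.
- by apply: mean2_ge0 => x y; exact: sqr_ge0.
pose ell S := \sum_j mean P (fun x => op P S (h j) x * h j x).
(* On an orbit kernel [ell] is the sum of squares in the statement; being linear, it keeps the lower
   bound e at midpoints. *)
have ell_ge S : midhull S -> e <= ell S.
  elim=> [g|Q1 Q2 C1 IH1 C2 IH2]; last first.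
    have -> : ell (fun x y => 2^-1 * (Q1 x y + Q2 x y)) = 2^-1 * (ell Q1 + ell Q2).
      rewrite /ell -big_split mulr_sumr /=; apply: eq_bigr => j _.
      have t1 := midhull_tens C1; have t2 := midhull_tens C2.
      have b0 := bh j.
      have b1 := bmf_op P1 t1 b0; have b2 := bmf_op P1 t2 b0.
      rewrite -meanD//; [|by bm..]; rewrite -meanZ//; [|by bm].
      by apply: eq_mean => x; rewrite opZ ?opD//; [ring|exact: tensD].
    by move: IH1 IH2; move: (ell Q1) (ell Q2) => a b ea eb; lra.
  apply: le_trans (ge g) _; rewrite le_eqVlt; apply/orP; left; apply/eqP.
  apply: eq_bigr => j _; have bj := bh j.
  have bfa i : bmf (fun x => f i (act g x)) by exact: bmf_comp.
  rewrite -(@eq_mean _ _ _ _ (fun x => \sum_i mean P (fun x => f i (act g x) * h j x) *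
     (f i (act g x) * h j x))).
    rewrite mean_sum//; last by bm.
    by apply: eq_bigr => i _; rewrite meanZ//; bm.
  move=> x; rewrite /op /orbit_kernel.
  rewrite (@eq_mean _ _ _ _ (fun y => _ * _)
     (fun y => \sum_i f i (act g x) * (f i (act g y) * h j y))).
    rewrite mean_sum//; last by bm.
    rewrite mulr_suml; apply: eq_bigr => i _; rewrite meanZ//; last by bm.
    by ring.
  by move=> y; rewrite mulr_suml; apply: eq_bigr => i _; rewrite mulrA.
have /choice[C hC] j :=
  minimizer_op_small Dle (fun n => (QD n).1) (fun n => (QD n).2) (bh j).
have : e <= 0.
  apply: (@le_of_le_add_geometric _ _ _ (\sum_j C j)) => n; rewrite add0r.
  apply: le_trans (ell_ge _ (QD n).1) _; rewrite mulr_suml.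
  by apply: ler_sum => j _; exact: hC.
by rewrite leNgt e0.
Qed.

End weak_mixing.

(** * Entropy bounds *)

Section entropy_bounds.
Context d (T : measurableType d) (R : realType).
Variable P : {measure set T -> \bar R}.
Hypothesis P1 : P setT = 1%E.
Variables (G : Type) (mul : G -> G -> G) (inv : G -> G) (act : G -> T -> T).
Hypothesis actM : forall g h x, act (mul g h) x = act g (act h x).
Hypothesis actV : forall g x, act g (act (inv g) x) = x.
Hypothesis act_meas : forall g, measurable_fun setT (act g).
Hypothesis act_pres : forall g B, measurable B -> P (act g @^-1` B) = P B.
Local Notation phi := (@entr_fun R).
Local Notation K := (kron P act).

Variables (I : finType) (a : T -> I) (e : I -> T -> R).
Hypothesis ma : mlab a.
Hypothesis bKe : forall i, bmfK K (e i).
Hypothesis e01 : forall i x, 0 <= e i x <= 1.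
Hypothesis e_cond : forall i B, K B ->
  mean P (fun x => \1_B x * ((a x == i)%:R - e i x)) = 0.

Let sK : sigma_algebra setT K.
Proof. exact: (kron_sigma_algebra P1 act_meas act_pres). Qed.
Let Kmeas B : K B -> measurable B. Proof. by case. Qed.
Let be i : bmf (e i). Proof. exact: (bmfK_bmf sK Kmeas). Qed.
Let ba i : bmf (fun x => (a x == i)%:R : R). Proof. exact: mlab_bmf. Qed.

Lemma bmf_entr_fun (u : T -> R) : bmf u -> (forall x, 0 <= u x <= 1) ->
  bmf (fun x => phi (u x)).
Proof.
move=> [mu _] u01; split.
  by apply: measurable_funN; apply: measurable_funM => //; exact: measurableT_comp.
exists 1 => x; have /andP[u0 _] := u01 x.
by rewrite ger0_norm ?entr_fun_le1 ?entr_fun_ge0.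
Qed.

Let bphi i : bmf (fun x => phi (e i x)).
Proof. exact: bmf_entr_fun. Qed.

(** When e i is the conditional expectation of the indicator of a = i, this is the conditional
    entropy of the partition given the Kronecker algebra. *)
Definition mean_entropy : R := \sum_i mean P (fun x => phi (e i x)).

Lemma mlab_act (J : finType) (f : T -> J) g : mlab f -> mlab (fun x => f (act g x)).
Proof.
move=> mf j; have := act_meas g measurableT (mf j).
by rewrite setTI.
Qed.

Lemma pr_act (J : finType) (f : T -> J) g j : mlab f ->
  pr P (fun x => f (act g x)) j = pr P f j.
Proof.
move=> mf; rewrite /pr.
by rewrite (mean_act P1 act_meas act_pres g (mlab_bmf R j mf)).
Qed.

Lemma H_act (J : finType) (f : T -> J) g : mlab f ->
  H P (fun x => f (act g x)) = H P f.
Proof. by move=> mf; apply: eq_bigr => j _; rewrite pr_act. Qed.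

(** Jensen's inequality for phi with weight w: writing p and q for the means of w and w u, the
    right-hand side is p phi (q / p) when p > 0. It follows by integrating the tangent at q / p. *)
Lemma jensen_entr_fun (w u : T -> R) : bmf w -> bmf u ->
  (forall x, 0 <= w x) -> (forall x, 0 <= u x <= 1) ->
  mean P (fun x => w x * phi (u x)) <=
  phi (mean P (fun x => w x * u x)) + mean P (fun x => w x * u x) * ln (mean P w).
Proof.
move=> bw bu w0 u01; set q := mean P (fun x => w x * u x); set p := mean P w.
have bpu : bmf (fun x => phi (u x)) by exact: bmf_entr_fun.
have q0 : 0 <= q.
  by apply: mean_ge0 => x; rewrite mulr_ge0//; have /andP[] := u01 x.
have qp : q <= p.
  apply: le_mean => //; [by bm|move=> x].
  by rewrite ler_piMr//; have /andP[] := u01 x.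
have tan t : 0 < t -> mean P (fun x => w x * phi (u x)) <= - (q * ln t) - q + t * p.
  move=> t0.
  have -> : - (q * ln t) - q + t * p = mean P (fun x =>
      (- ln t - 1) * (w x * u x) + t * w x).
    rewrite meanD ?meanZ//; [|by bm..].
    by rewrite -/q -/p; ring.
  apply: le_mean => //; [by bm..|move=> x].
  have /andP[u0 _] := u01 x.
  have := ler_wpM2l (w0 x) (entr_fun_tangent u0 t0).
  by move: (ln t) (u x) (w x) (phi _) => l u' w' y; lra.
have [p_eq0|pN0] := eqVneq p 0.
  have q_eq0 : q = 0 by apply/eqP; rewrite eq_le q0 -p_eq0 qp.
  rewrite q_eq0 entr_fun0 mul0r addr0 -p_eq0; apply: le_mean => //; [by bm|move=> x].
  by rewrite ler_piMr//; apply: entr_fun_le1; have /andP[] := u01 x.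
have p_gt0 : 0 < p by rewrite lt_neqAle eq_sym pN0 (le_trans q0).
have [q_eq0|qN0] := eqVneq q 0.
  (* For q = 0 there is no tangent at q / p; the tangents at r / p bound the mean by r for every r >
     0. *)
  rewrite q_eq0 entr_fun0 mul0r addr0; apply/ler_addgt0Pr => r r0.
  have := tan (r / p) (divr_gt0 r0 p_gt0).
  by rewrite q_eq0 divfK//; move: (mean P _) => m; lra.
have q_gt0 : 0 < q by rewrite lt_neqAle eq_sym qN0.
have := tan (q / p) (divr_gt0 q_gt0 p_gt0); rewrite divfK// ln_div ?posrE//.
by rewrite /entr_fun; move: (mean P _) (ln q) (ln p) => m lq lp; lra.
Qed.

Lemma mean_label_sum (J : finType) (f : T -> J) (w : T -> R) : mlab f -> bmf w ->
  \sum_j mean P (fun x => (f x == j)%:R * w x) = mean P w.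
Proof.
move=> mf bw; have bfj j : bmf (fun x => (f x == j)%:R : R) by exact: mlab_bmf.
rewrite -mean_sum//; last by bm.
apply: eq_mean => x; rewrite (bigD1 (f x))//= eqxx mul1r big1 ?addr0// => j.
by rewrite eq_sym => /negbTE ->; rewrite mul0r.
Qed.

(** The chosen versions add up to 1 only almost everywhere: their sum minus 1 is measurable for the
    algebra and orthogonal to it. *)
Lemma sum_cond_exp : mean P (fun x => `|\sum_i e i x - 1|) = 0.
Proof.
have bKs : bmfK K (fun x => \sum_i e i x - 1).
  by apply: bmfB; [apply: bmf_sum => i; exact: bKe|exact: bmf_cst].
have b1 : bmf (fun x => \sum_i e i x - 1) by exact: (bmfK_bmf sK Kmeas).
apply: (mean_norm_eq0 P1 Kmeas b1);
  [exact: (bmfK_gt sK 0 bKs)|exact: (bmfK_lt sK 0 bKs)|].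
move=> B KB; have bB : bmf (\1_B : T -> R) by exact/bmf_indic/Kmeas.
rewrite (@eq_mean _ _ _ _ _ (fun x => - \sum_i \1_B x * ((a x == i)%:R - e i x))).
  have bt i : bmf (fun x => \1_B x * ((a x == i)%:R - e i x)).
    by have := ba i => bai; bm.
  rewrite (@eq_mean _ _ _ _ _ (fun x => (-1) * \sum_i \1_B x * ((a x == i)%:R - e i x))).
    rewrite meanZ//; last by bm.
    by rewrite mean_sum// big1 ?mulr0// => i _; exact: e_cond.
  by move=> x; rewrite mulN1r.
move=> x; rewrite -mulr_sumr -mulrN; congr (_ * _); rewrite sumrB opprB.
suff -> : \sum_i (a x == i)%:R = 1 :> R by [].
rewrite (bigD1 (a x))//= eqxx big1 ?addr0// => i.
by rewrite eq_sym => /negbTE ->.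
Qed.

(** With p the joint law of a(gx) and f(x), and q the law obtained by replacing the indicator of a =
    i by e i, weak mixing makes p close to q, and Jensen bounds the entropy increment of q from
    below. *)
Lemma exists_entropy_step (J : finType) (f : T -> J) (g0 : G) : mlab f ->
  forall r, 0 < r -> exists g,
  mean_entropy - r <= H P (fun x => (a (act g x), f x)) - H P f.
Proof.
move=> mf r r0.
(* Each of the |I| |J| entries will cost 2 s; the extra 1 keeps N positive. *)
pose N : R := 2 * #|I|%:R * #|J|%:R + 1.
have N0 : 0 < N by rewrite ltr_wpDl// !mulr_ge0.
pose s := r / N; have s0 : 0 < s by exact: divr_gt0.
have bj j : bmf (fun x => (f x == j)%:R : R) by exact: mlab_bmf.
pose fi i x := (a x == i)%:R - e i x.
have bfi i : bmf (fi i) by rewrite /fi; have := ba i => bai; bm.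
have orth i B : K B -> mean P (fun x => \1_B x * fi i x) = 0 by exact: e_cond.
(* A sum of squares below s^4 gives |p - q| <= s^2, and the square root in the modulus of continuity
   of phi brings this down to s. *)
have [g hg] := weak_mixing P1 actM actV act_meas act_pres bfi orth g0 bj
  (exprn_gt0 4 s0).
exists g.
pose p i j := pr P (fun x => (a (act g x), f x)) (i, j).
pose q i j := mean P (fun x => (f x == j)%:R * e i (act g x)).
have bag i : bmf (fun x => (a (act g x) == i)%:R : R).
  by apply: mlab_bmf; exact: (mlab_act g ma).
have beg i : bmf (fun x => e i (act g x)) by exact: bmf_comp.
have mag : mlab (fun x => a (act g x)) by exact: mlab_act.
have pq i j : `|p i j - q i j| <= s ^+ 2.
  have b1 : bmf (fun x => (a (act g x) == i)%:R * (f x == j)%:R : R).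
    by have := bag i; have := bj j => ? ?; bm.
  have b2 : bmf (fun x => (f x == j)%:R * e i (act g x)).
    by have := beg i; have := bj j => ? ?; bm.
  have -> : p i j - q i j = mean P (fun x => fi i (act g x) * (f x == j)%:R).
    rewrite /p /pr -(@eq_mean _ _ _ _ (fun x => (a (act g x) == i)%:R * (f x == j)%:R)).
      rewrite -meanB//; apply: eq_mean => x; rewrite /fi.
      by ring.
    by move=> x; rewrite xpair_eqE -natrM mulnb.
  rewrite -(@ler_pXn2r _ 2)// ?nnegrE// ?sqr_ge0//.
  rewrite real_normK ?num_real// -exprM.
  apply: le_trans (ltW hg); rewrite (bigD1 j)//= (bigD1 i)//= -addrA lerDl.
  rewrite addr_ge0//; first by apply: sumr_ge0 => ? _; exact: sqr_ge0.
  by apply: sumr_ge0 => ? _; apply: sumr_ge0 => ? _; exact: sqr_ge0.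
have q01 i j : 0 <= q i j <= 1.
  apply/andP; split.
    by apply: mean_ge0 => x; rewrite mulr_ge0//; have /andP[] := e01 i (act g x).
  rewrite -[leRHS](mean_cst P1); apply: le_mean => //; [|exact: bmf_cst|].
    by have := beg i; have := bj j => ? ?; bm.
  move=> x; have /andP[e0 e1] := e01 i (act g x).
  by case: (f x == j); rewrite ?mul1r ?mul0r.
have mp : mlab (fun x => (a (act g x), f x)) by exact: mlab_pair.
have p01 i j : 0 <= p i j <= 1 by rewrite pr_ge0 pr_le1.
have phipq i j : phi (q i j) - 2 * s <= phi (p i j).
  have := entr_fun_unif_cont (p01 i j) (q01 i j).
  have : Num.sqrt `|p i j - q i j| <= s.
    rewrite [leRHS](_ : s = Num.sqrt (s ^+ 2)); first by rewrite ler_wsqrtr.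
    by rewrite sqrtr_sqr gtr0_norm.
  rewrite ler_norml; move: (Num.sqrt _) (phi (p i j)) (phi (q i j)) => y u v.
  by move=> ys /andP[h1 h2]; lra.
have qsum j : \sum_i q i j = pr P f j.
  have b0 := bj j; have b1 i : bmf (fun x => (f x == j)%:R * e i (act g x)).
    by have := beg i => ?; bm.
  have b2 : bmf (fun x => \sum_i e i x - 1) by bm.
  have b3 : bmf (fun x => \sum_i e i (act g x) - 1) by bm.
  rewrite /q -mean_sum// /pr; apply/eqP; rewrite -subr_eq0 -meanB//; [|by bm..].
  rewrite -normr_le0; have b4 := bmf_norm b2.
  apply: (@le_trans _ _ (mean P (fun x => `|\sum_i e i (act g x) - 1|))); last first.
    by rewrite (mean_act P1 act_meas act_pres g b4) sum_cond_exp.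
  apply: le_trans (norm_mean P1 _) _; first by bm.
  apply: le_mean => //; [by bm..|move=> x].
  rewrite -mulr_sumr; case: (f x == j); rewrite ?mul1r//.
  by rewrite !mul0r subrr normr0.
have Jen j : \sum_i mean P (fun x => (f x == j)%:R * phi (e i (act g x))) <=
    \sum_i phi (q i j) - phi (pr P f j).
  have -> : \sum_i phi (q i j) - phi (pr P f j) =
      \sum_i (phi (q i j) + q i j * ln (pr P f j)).
    rewrite big_split /= -mulr_suml qsum /entr_fun opprK; reflexivity.
  by apply: ler_sum => i _; apply: jensen_entr_fun => //.
have HE : H P (fun x => (a (act g x), f x)) = \sum_j \sum_i phi (p i j).
  by rewrite exchange_big pair_bigA; apply: eq_bigr => -[].
have Jensum : mean_entropy <= \sum_j \sum_i phi (q i j) - H P f.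
  rewrite -sumrB; apply: le_trans (ler_sum _ (fun j _ => Jen j)).
  rewrite exchange_big /=; apply: ler_sum => i _.
  rewrite (@mean_label_sum _ f (fun x => phi (e i (act g x))))//;
    last exact: (bmf_comp (act_meas g) (bphi i)).
  by rewrite (mean_act P1 act_meas act_pres g (bphi i)).
have psum : \sum_j \sum_i phi (q i j) - r <= \sum_j \sum_i phi (p i j).
  have : \sum_j \sum_i phi (q i j) - 2 * s * #|I|%:R * #|J|%:R <=
      \sum_j \sum_i phi (p i j).
    rewrite -mulr_natr !mulr_natr -!sumr_const -sumrB; apply: ler_sum => j _.
    by rewrite -sumrB; apply: ler_sum => i _; exact: phipq.
  have : N * s = r by rewrite /s mulrC divfK ?gt_eqF.
  rewrite /N; move: (\sum_j _) (\sum_j _) (#|I|%:R) (#|J|%:R) => x y m n Ns xy.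
  by rewrite -Ns; lra.
by move: Jensum psum; rewrite HE; move: (H _ _) (\sum_j _) (\sum_j _) => *; lra.
Qed.

Lemma join_lower_bound (g0 : G) r : 0 < r -> exists s : nat -> G, forall n,
  n%:R * (mean_entropy - r) <= H P (join (fun i x => a (act (s i) x)) n).
Proof.
move=> r0.
have mj (s : nat -> G) n : mlab (join (fun i x => a (act (s i) x)) n).
  by apply: mlab_join => i; exact: (mlab_act (s i) ma).
(* [nxt] chooses the next group element from the sequence chosen so far and its length. *)
have /choice[nxt hnxt] (sn : (nat -> G) * nat) : exists g, mean_entropy - r <=
    H P (fun x => (a (act g x), join (fun i x => a (act (sn.1 i) x)) sn.2 x)) -
    H P (join (fun i x => a (act (sn.1 i) x)) sn.2).
  exact: (exists_entropy_step g0 (mj sn.1 sn.2) r0).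
(* [hist n] holds the first n choices and the filler g0 from index n on; below n it agrees with
   s. *)
pose fix hist n : nat -> G := if n is m.+1 then
  fun i => if i == m then nxt (hist m, m) else hist m i else fun=> g0.
pose s n := nxt (hist n, n).
have hist_s n i : (i < n)%N -> hist n i = s i.
  elim: n => [//|n IH]; rewrite ltnS /=; case: eqP => [-> //|/eqP ni] le_in.
  by apply: IH; rewrite ltn_neqAle ni.
have joinE n : join (fun i x => a (act (hist n i) x)) n =
    join (fun i x => a (act (s i) x)) n.
  by apply/funext => x; apply/ffunP => i; rewrite !ffunE hist_s.
exists s; elim=> [|n IH]; first by rewrite mul0r H_ge0.
have := hnxt (hist n, n); rewrite /= joinE => hn.
have : H P (fun x => (a (act (nxt (hist n, n)) x), join (fun i x => a (act (s i) x)) n x))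
    <= H P (join (fun i x => a (act (s i) x)) n.+1).
  apply: (@H_factor _ _ _ _ P1 _ _ _ _ (fun c : {ffun 'I_n.+1 -> I} =>
    (c ord_max, [ffun i => c (lift ord_max i)]))) => //.
  move=> x; rewrite ffunE; congr pair; apply/ffunP => i; rewrite !ffunE.
  by rewrite /= /bump leqNgt ltn_ord.
by rewrite -natr1 mulrDl mul1r; lra.
Qed.

(** [0, 1] is cut into intervals of length 1/N <= r, and b records for every i the one containing e
    i x. *)
Lemma exists_level_partition r : 0 < r -> exists (L : finType) (b : T -> L),
  (forall l, K [set x | b x == l]) /\
  (forall i x y, b x = b y -> `|e i x - e i y| <= r).
Proof.
move=> r0; pose N := (Num.truncn r^-1).+1.
have N0 : 0 < N%:R :> R by [].
have Nr : N%:R^-1 <= r.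
  by rewrite invf_ple ?posrE//; apply/ltW; exact: truncnS_gt.
pose t i x := Num.truncn (e i x * N%:R).
have t_le i x : (t i x)%:R <= e i x * N%:R.
  by rewrite truncn_le mulr_ge0//; have /andP[] := e01 i x.
have t_gt i x : e i x * N%:R < (t i x)%:R + 1 by rewrite natr1; exact: truncnS_gt.
(* The value e i x = 1 has index N, so N + 1 levels are needed. *)
have tN i x : (t i x < N.+1)%N.
  rewrite ltnS -(ler_nat R); apply: le_trans (t_le i x) _.
  by rewrite ler_piMl//; have /andP[] := e01 i x.
pose b x := [ffun i => Ordinal (tN i x)].
exists {ffun I -> 'I_N.+1}, b; split.
  suff mb : @mlab _ (g_sigma_algebraType K) _ b.
    by move=> l; have := mb l; rewrite sigma_algebra_measurableE.
  apply: mlab_ffun => i j; rewrite sigma_algebra_measurableE//.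
  have := bmfK_preimage sK (bKe i) (measurable_itv `[j%:R / N%:R, (j%:R + 1) / N%:R[).
  congr K; apply/seteqP; split => x /=; rewrite in_itv/= -val_eqE/=.
    move=> /andP[h1 h2].
    rewrite ler_pdivrMr// in h1; rewrite ltr_pdivlMr// in h2.
    rewrite /t; apply/eqP; apply: truncn_def => //.
    by rewrite h1/= -natr1.
  by move=> /eqP <-; rewrite ler_pdivrMr// t_le/= ltr_pdivlMr// t_gt.
move=> i x y /ffunP /(_ i); rewrite !ffunE => -[txy].
apply: le_trans Nr; rewrite -(ler_pM2r N0) mulVf ?gt_eqF//.
rewrite -[X in _ * X](ger0_norm (ltW N0)) -normrM mulrBl ler_norml.
have := t_le i x; have := t_le i y; have := t_gt i x; have := t_gt i y.
by rewrite txy => *; apply/andP; split; lra.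
Qed.

(** On an atom of b of positive measure, the conditional probability of a = i is the average of e i,
    hence within r of e i there; the modulus of continuity of phi gives the error term. *)
Lemma level_partition_entropy (L : finType) (b : T -> L) r : 0 <= r <= 1 ->
  (forall l, K [set x | b x == l]) ->
  (forall i x y, b x = b y -> `|e i x - e i y| <= r) ->
  H P (fun x => (a x, b x)) - H P b <= mean_entropy + #|I|%:R * (2 * Num.sqrt r).
Proof.
move=> /andP[r0 r1] Kb br; have mb : mlab b by move=> l; exact: Kmeas.
have mab : mlab (fun x => (a x, b x)) by exact: mlab_pair.
set s := 2 * Num.sqrt r; have s0 : 0 <= s by rewrite mulr_ge0 ?sqrtr_ge0.
have bb l : bmf (fun x => (b x == l)%:R : R) by exact: mlab_bmf.
pose p i l := pr P (fun x => (a x, b x)) (i, l).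
have p0 i l : 0 <= p i l by exact: pr_ge0.
have psum l : pr P b l = \sum_i p i l by exact: pr_pair2.
(* The atoms of b lie in the Kronecker algebra, so the indicator of a = i may be replaced by e i
   under the integral. *)
have pE i l : p i l = mean P (fun x => (b x == l)%:R * e i x).
  have := e_cond i (Kb l).
  under eq_mean do rewrite indic_bool mulrBr.
  have b1 := bb l; have b2 := ba i.
  rewrite meanB//; [|by bm..]; move/eqP; rewrite subr_eq0 => /eqP <-.
  by apply: eq_mean => x; rewrite xpair_eqE -natrM mulnb andbC.
have key l : \sum_i phi (p i l) - phi (pr P b l) <=
    \sum_i mean P (fun x => (b x == l)%:R * (phi (e i x) + s)).
  have p_le i : p i l <= pr P b l by rewrite psum (bigD1 i)//= lerDl sumr_ge0.
  have rhs0 i : 0 <= mean P (fun x => (b x == l)%:R * (phi (e i x) + s)).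
    apply: mean_ge0 => x; rewrite mulr_ge0// addr_ge0//.
    exact: entr_fun_ge0.
  have := pr_ge0 P b l; rewrite le_eqVlt => /orP[/eqP pl0|pl].
    rewrite -pl0 entr_fun0 subr0; apply: ler_sum => i _.
    have -> : p i l = 0 by apply/eqP; rewrite eq_le p0 pl0 p_le.
    by rewrite entr_fun0.
  pose t i := p i l / pr P b l.
  have t01 i : 0 <= t i <= 1.
    apply/andP; split; first exact: divr_ge0 (p0 _ _) (ltW pl).
    by rewrite ler_pdivrMr// mul1r.
  have te i x : b x = l -> `|e i x - t i| <= r.
    move=> bx; have b1 := bb l; have b2 := be i.
    rewrite -(ler_pM2r pl) -[X in _ * X <= _](ger0_norm (ltW pl)) -normrM mulrBl.
    rewrite /t divfK ?gt_eqF// pE /pr -meanZ//; rewrite -meanB//; [|by bm..].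
    rewrite -meanZ//; apply: le_trans (norm_mean P1 _) _; first by bm.
    apply: le_mean => //; [by bm..|move=> y].
    rewrite (_ : _ - _ = (b y == l)%:R * (e i x - e i y)); last by ring.
    rewrite normrM normr_nat mulrC.
    have [byl|_] := eqVneq (b y) l; last by rewrite !mulr0.
    by rewrite !mulr1; apply: br; rewrite byl.
  have phip i : phi (p i l) = t i * phi (pr P b l) + pr P b l * phi (t i).
    rewrite -entr_funM; [|exact: ltW|by case/andP: (t01 i)].
    by rewrite /t mulrC divfK ?gt_eqF.
  have tsum : \sum_i t i = 1 by rewrite -mulr_suml -psum divff ?gt_eqF.
  under eq_bigr do rewrite phip.
  rewrite big_split /= -mulr_suml tsum mul1r addrAC subrr add0r.
  apply: ler_sum => i _; rewrite mulrC /pr.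
  have b1 := bb l; have b2 := bphi i.
  rewrite -meanZ//; apply: le_mean => //; [by bm..|move=> x].
  rewrite mulrC; have [bx|_] := eqVneq (b x) l; last by rewrite !mul0r.
  rewrite !mul1r; have := entr_fun_unif_cont (t01 i) (e01 i x).
  have := te i x bx; rewrite distrC => h1.
  have h2 : Num.sqrt `|t i - e i x| <= Num.sqrt r by rewrite ler_wsqrtr.
  rewrite ler_norml /s; move: (Num.sqrt _) (Num.sqrt _) h2 (phi _) (phi _).
  by move=> y z yz u v /andP[h3 h4]; lra.
have HE : H P (fun x => (a x, b x)) = \sum_l \sum_i phi (p i l).
  by rewrite exchange_big pair_bigA; apply: eq_bigr => -[].
rewrite HE -sumrB; apply: le_trans (ler_sum _ (fun l _ => key l)) _.
rewrite exchange_big /= /mean_entropy mulr_natl -sumr_const -big_split /=.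
apply: ler_sum => i _.
rewrite (@mean_label_sum _ b (fun x => phi (e i x) + s))//.
  by rewrite meanD//; [rewrite mean_cst|exact: bmf_cst].
by have := bphi i => ?; bm.
Qed.

(** Conditioning on the finer label c lowers the entropy: submodularity, where the pair (c, h)
    carries no more information than c. *)
Lemma H_cond_factor (I1 L1 L2 : finType) (f : T -> I1) (c : T -> L1) (h : T -> L2)
  (u : L1 -> L2) : mlab f -> mlab c -> h =1 (fun x => u (c x)) ->
  H P (fun x => (f x, c x)) - H P c <= H P (fun x => (f x, h x)) - H P h.
Proof.
move=> mf mc hu; have mh : mlab h.
  by have -> : h = (fun x => u (c x)); [exact/funext|exact: mlab_comp].
have := H_submod P1 mf mc mh.
have : H P (fun x => (c x, h x)) <= H P c.
  by apply: (@H_factor _ _ _ _ P1 _ _ _ _ (fun l => (l, u l))) => // x; rewrite hu.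
have : H P (fun x => (f x, c x)) <= H P (fun x => (f x, (c x, h x))).
  apply: (@H_factor _ _ _ _ P1 _ _ _ _ (fun q => (q.1, q.2.1))) => //.
  by apply: mlab_pair => //; exact: mlab_pair.
by move: (H _ _) (H _ _) (H _ _) (H _ _) (H _ _) => *; lra.
Qed.

(** By invariance a and b may both be translated by g; replacing b(gx) by b(hx) then changes each
    joint probability by at most r. *)
Lemma H_pair_shift (L : finType) (b : T -> L) g h r : mlab b -> 0 <= r ->
  (forall l, orbit_dist P act (fun x => (b x == l)%:R) g h <= r) ->
  H P (fun x => (a (act g x), b (act h x))) <=
  H P (fun x => (a x, b x)) + #|I|%:R * #|L|%:R * (2 * Num.sqrt r).
Proof.
move=> mb r0 hr; have mab : mlab (fun x => (a x, b x)) by exact: mlab_pair.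
rewrite -(H_act g mab) /H -natrM -card_prod.
rewrite mulr_natl -sumr_const -big_split /=; apply: ler_sum => -[i l] _.
set p := pr _ _ _; set q := pr _ _ _.
have mag k : mlab (fun x => a (act k x)) by exact: mlab_act.
have mbg k : mlab (fun x => b (act k x)) by exact: mlab_act.
have pq : `|p - q| <= r.
  apply: le_trans (hr l).
  have b1 : bmf (fun x => ((a (act g x), b (act h x)) == (i, l))%:R : R).
    by apply: mlab_bmf; exact: mlab_pair.
  have b2 : bmf (fun x => ((a (act g x), b (act g x)) == (i, l))%:R : R).
    by apply: mlab_bmf; exact: mlab_pair.
  have b3 : bmf (fun x => (b (act g x) == l)%:R : R) by exact: (mlab_bmf _ _ (mbg g)).
  have b4 : bmf (fun x => (b (act h x) == l)%:R : R) by exact: (mlab_bmf _ _ (mbg h)).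
  rewrite /p /q /pr -meanB//; apply: le_trans (norm_mean P1 _) _; first by bm.
  apply: le_mean => //; [by bm..|move=> x]; rewrite !xpair_eqE distrC.
  case: (_ == i) => //=; by rewrite subrr normr0.
have p01 : 0 <= p <= 1 by rewrite pr_ge0 pr_le1//; exact: mlab_pair.
have q01 : 0 <= q <= 1 by rewrite pr_ge0 pr_le1//; exact: mlab_pair.
have := entr_fun_unif_cont p01 q01.
have : Num.sqrt `|p - q| <= Num.sqrt r by rewrite ler_wsqrtr.
rewrite ler_norml; move: (Num.sqrt _) (Num.sqrt _) (phi _) (phi _).
by move=> y z u v yz /andP[h3 h4]; lra.
Qed.

(** C is uniform in s and n: it is the entropy of the join of finitely many translates of b that
    approximate all its translates. *)
Lemma join_upper_bound (g0 : G) r : 0 < r -> exists C, forall (s : nat -> G) n,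
  H P (join (fun i x => a (act (s i) x)) n) <= C + n%:R * (mean_entropy + r).
Proof.
move=> r0.
have small (M : R) : 0 <= M ->
    exists t, [/\ 0 < t, t <= 1 & M * (2 * Num.sqrt t) <= r / 2].
  move=> M0; have D0 : 0 < 4 * M + 4 + r by lra.
  pose y := r / (4 * M + 4 + r); have y0 : 0 < y by exact: divr_gt0.
  have yr : y * (4 * M + 4 + r) = r by rewrite /y divfK ?gt_eqF.
  exists (y ^+ 2); rewrite exprn_gt0// sqrtr_sqr gtr0_norm//; split => //.
    have y1 : y <= 1 by rewrite /y ler_pdivrMr// mul1r; lra.
    exact: exprn_ile1 (ltW y0) y1.
  have : 0 <= y * M by rewrite mulr_ge0// ltW.
  have : 0 <= y * r by rewrite mulr_ge0// ltW.
  by lra.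
have [t [t0 t1 ht]] := small _ (ler0n R #|I|).
have [L [b [Kb br]]] := exists_level_partition t0.
have mb : mlab b by move=> l; exact: Kmeas.
have t01 : 0 <= t <= 1 by rewrite ltW.
have hab := level_partition_entropy t01 Kb br.
have LI0 : 0 <= #|I|%:R * #|L|%:R :> R by rewrite mulr_ge0.
have [u [u0 _ hu]] := small _ LI0.
have tb : tot_bounded (fun g h => \sum_l orbit_dist P act (fun x => (b x == l)%:R) g h).
  apply: tot_bounded_sum => l; have [_] := Kb l; congr tot_bounded.
  by congr orbit_dist; apply/funext => x; rewrite indic_bool.
have [J [c hc]] := tb u u0.
(* One group element is chosen in each colour class; colours that do not occur receive g0. *)
have /choice[rep hrep] (j : J) : exists g, forall g', c g' = j -> c g = j.
  have [[g' <-]|nj] := pselect (exists g', c g' = j); first by exists g'.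
  by exists g0 => g' gj; case: nj; exists g'.
pose gam x := [ffun j => b (act (rep j) x)].
have mgam : mlab gam by apply: mlab_ffun => j; exact: mlab_act.
exists (H P gam) => s n.
have mas i : mlab (fun x => a (act (s i) x)) by exact: mlab_act.
have mj : mlab (join (fun i x => a (act (s i) x)) n) by exact: mlab_join.
apply: le_trans (_ : H P (fun x => (join (fun i x => a (act (s i) x)) n x, gam x)) <= _).
  by apply: (@H_factor _ _ _ _ P1 _ _ _ _ fst) => //; exact: mlab_pair.
apply: le_trans (H_join_le P1 n mas mgam) _; rewrite lerD2l.
rewrite mulr_natl -[in leRHS](card_ord n) -sumr_const; apply: ler_sum => i _.
set h := rep (c (s i)).
have mbh : mlab (fun x => b (act h x)) by exact: mlab_act.
have hf : (fun x => b (act h x)) =1 (fun x => gam x (c (s i))) by move=> x; rewrite ffunE.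
apply: le_trans
  (H_cond_factor (u := fun v : {ffun J -> L} => v (c (s i))) (mas i) mgam hf) _.
have cs : c (s i) = c h by rewrite (hrep (c (s i)) (s i)).
have od l : orbit_dist P act (fun x => (b x == l)%:R) (s i) h <= u.
  apply: le_trans (ltW (hc _ _ cs)); rewrite (bigD1 l)//= lerDl sumr_ge0// => k _.
  by apply: mean_ge0 => x; exact: normr_ge0.
have := H_pair_shift mb (ltW u0) od; rewrite (H_act h mb).
move: hab ht hu; move: (H P _) (H P _) (H P _) (_ * (2 * _)) (_ * (2 * _)).
by move=> x y z v w *; lra.
Qed.

End entropy_bounds.

(** * The completed measure *)

Section completion.
Context d (T : measurableType d) (R : realType).
Variable mu : {measure set T -> \bar R}.
Hypothesis mu_fin : (mu setT < +oo)%E.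
Local Open Scope ereal_scope.

Let I : measurableType _ := caratheodory_type (mu_ext mu).
Let mub : {measure set I -> \bar R} := @completed_measure_extension _ _ _ mu.

Lemma completion_measurable (B : set T) : measurable B -> measurable (B : set I).
Proof. exact: caratheodory_measurable_mu_ext. Qed.

Lemma completion_measureE (B : set T) : measurable B -> mub B = mu B.
Proof. exact: measurable_mu_extE. Qed.

Lemma completion_negligible (N : set T) : mu.-negligible N -> measurable (N : set I).
Proof.
move=> [M [mM M0 NM]]; apply: measure_is_complete_caratheodory.
exists M; split => //; first exact: completion_measurable.
exact: (etrans (completion_measureE mM)).
Qed.

(** A measurable hull: B is the intersection of countable covers whose total measures exceed the
    outer measure by at most 1/(n+1). *)
Lemma completion_sandwich (E : set T) : exists B : set T,
  [/\ measurable B, E `<=` B & mu B <= mu_ext mu E].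
Proof.
have Efin : mu_ext mu E \is a fin_num.
  rewrite ge0_fin_numE ?mu_ext_ge0//.
  apply: le_lt_trans (_ : mu_ext mu setT < +oo); first exact: le_mu_ext.
  by rewrite measurable_mu_extE.
have /choice[A hA] (n : nat) : exists A : (set T)^nat, measurable_cover E A /\
    \sum_(k <oo) mu (A k) < mu_ext mu E + (n.+1%:R^-1)%:E.
  have n0 : (0 < n.+1%:R^-1 :> R)%R by rewrite invr_gt0.
  by have [_ [A cA <-] ?] := lb_ereal_inf_adherent n0 Efin; exists A.
pose F n := \bigcup_k A n k.
have mF n : measurable (F n).
  by apply: bigcupT_measurable => k; have [[mA _] _] := hA n; exact: mA.
have mB : measurable (\bigcap_n F n) by exact: bigcapT_measurable.
exists (\bigcap_n F n); split => //.
  by move=> x Ex n _; have [[_ EA] _] := hA n; exact: EA.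
apply/lee_addgt0Pr => e e0.
have [n hn] : exists n : nat, (n.+1%:R^-1 < e)%R.
  by have [n] := ltr_add_invr e0; rewrite add0r; exists n.
apply: (@le_trans _ _ (mu (F n))).
  by apply: le_measure; rewrite ?inE//; exact: bigcap_inf.
have [[mA _] hs] := hA n.
apply: (@le_trans _ _ (\sum_(k <oo) mu (A n k))).
  exact: measure_sigma_subadditive.
by apply: le_trans (ltW hs) _; rewrite leeD2l// lee_fin ltW.
Qed.

(** B is a hull of E, and a hull of B minus E is a null set, because the finite measures of B and E
    coincide. *)
Lemma measurable_completion (E : set I) : measurable E ->
  exists B : set T, measurable B /\ mu.-negligible ((E `\` B) `|` (B `\` E)).
Proof.
move=> mE; have [B [mB EB BE]] := completion_sandwich E.
exists B; split => //.
have [M [mM BM M0]] := completion_sandwich (B `\` E).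
have mBfin : mub B < +oo.
  rewrite completion_measureE//; apply: le_lt_trans mu_fin.
  by apply: le_measure; rewrite ?inE.
have mBI := completion_measurable mB.
exists M; split => //; last first.
  by move=> x [[Ex nBx]|]; [have := EB x Ex|exact: BM].
apply/eqP; rewrite eq_le measure_ge0 andbT; apply: le_trans M0 _.
have : mub (B `\` E) = mub B - mub E.
  rewrite measureD//; congr (_ - mub _); exact/setIidPr.
rewrite /mub/= /completed_measure_extension => ->.
rewrite [X in X - _](_ : _ = mu B); last exact: completion_measureE.
have BEfin : mu_ext mu E \is a fin_num.
  rewrite ge0_fin_numE ?mu_ext_ge0//.
  apply: le_lt_trans (_ : mu_ext mu setT < +oo); first exact: le_mu_ext.
  by rewrite measurable_mu_extE.
by rewrite leeBlDr// add0e.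
Qed.

Lemma completion_measurableP (E : set T) : measurable (E : set I) <->
  exists B : set T, measurable B /\ mu.-negligible ((E `\` B) `|` (B `\` E)).
Proof.
split; first exact: measurable_completion.
move=> [B [mB nEB]].
have n1 : mu.-negligible (E `\` B) by apply: negligibleS nEB; exact: subsetUl.
have n2 : mu.-negligible (B `\` E) by apply: negligibleS nEB; exact: subsetUr.
have -> : E = (B `\` (B `\` E)) `|` (E `\` B).
  apply/seteqP; split => x; last first.
    by move=> [[Bx nBE]|[]//]; apply: contrapT => nEx; apply: nBE.
  by have [Bx|nBx] := pselect (B x) => Ex; [left; split => // -[]|right].
by apply: (@measurableU _ I); [apply: (@measurableD _ I)|];
  [exact: completion_measurable|exact: completion_negligible..].
Qed.

Variables (u : T -> T).
Hypothesis u_meas : measurable_fun setT u.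
Hypothesis u_pres : forall B, measurable B -> mu (u @^-1` B) = mu B.

Let mpre (B : set T) : measurable B -> measurable (u @^-1` B).
Proof. by move=> mB; rewrite -[X in measurable X]setTI; exact: u_meas. Qed.

Lemma completion_measurable_fun : measurable_fun [set: I] (u : I -> I).
Proof.
move=> _ E mE; rewrite setTI; apply/completion_measurableP.
have [B [mB [M [mM M0 sub]]]] := measurable_completion mE.
exists (u @^-1` B); split; first exact: mpre.
exists (u @^-1` M); split; [exact: mpre|by rewrite u_pres|].
by move=> x h; apply: sub; exact: h.
Qed.

Lemma completion_le (E F M : set T) : measurable (E : set I) -> measurable F ->
  measurable M -> mu M = 0 -> E `<=` F `|` M -> mub E <= mu F.
Proof.
move=> mE mF mM M0 EFM; have mFM : measurable (F `|` M) by exact: measurableU.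
apply: (@le_trans _ _ (mub (F `|` M))); first exact: le_mu_ext.
rewrite completion_measureE//; apply: le_trans (measureU2 mu mF mM) _.
by rewrite [X in _ + X](_ : _ = 0) ?adde0//; exact: M0.
Qed.

(** E differs from a Borel set B by a subset of a null set M; the preimages of B and M play the same
    role for the preimage of E. *)
Lemma completion_preserving (E : set I) : measurable E ->
  mub (u @^-1` E) = mub E.
Proof.
move=> mE; have [B [mB [M [mM M0 sub]]]] := measurable_completion mE.
have le1 : forall B' M' (E' : set T), measurable (E' : set I) -> measurable B' ->
    measurable M' -> mu M' = 0 -> (E' `\` B') `|` (B' `\` E') `<=` M' -> mub E' = mu B'.
  move=> B' M' E' mE' mB' mM' M'0 sub'; apply/eqP; rewrite eq_le; apply/andP; split.
    apply: completion_le M'0 _ => // x E'x; have [|nB] := pselect (B' x); first by left.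
    by right; apply: sub'; left.
  rewrite -completion_measureE//.
  have mM'I := completion_measurable mM'.
  apply: (@le_trans _ _ (mub (E' `|` M'))).
    apply: le_mu_ext => x B'x; have [|nE] := pselect (E' x); first by left.
    by right; apply: sub'; right.
  apply: le_trans (measureU2 mub mE' mM'I) _.
  rewrite [X in _ + X](_ : _ = 0) ?adde0//.
  exact: (etrans (completion_measureE mM') M'0).
rewrite (le1 _ _ _ mE mB mM M0 sub) -(u_pres mB).
apply: (le1 _ (u @^-1` M)); [|exact: mpre..|by rewrite u_pres|].
- by have := completion_measurable_fun measurableT mE; rewrite setTI.
- by move=> x h; apply: sub; exact: h.
Qed.

End completion.

(** * Almost everywhere uniqueness of conditional expectations *)

Section integrable_ae.
Context d (T : measurableType d) (R : realType).
Variable P : {measure set T -> \bar R}.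
Local Open Scope ereal_scope.

(** On this set g - f is positive with integral zero. *)
Lemma integrable_gt_negligible (f g : T -> R) :
  P.-integrable setT (EFin \o f) -> P.-integrable setT (EFin \o g) ->
  measurable [set x | (f x < g x)%R] ->
  \int[P]_(x in [set x | (f x < g x)%R]) (f x)%:E =
    \int[P]_(x in [set x | (f x < g x)%R]) (g x)%:E ->
  P.-negligible [set x | (f x < g x)%R].
Proof.
set D := [set x | (f x < g x)%R] => fi gi mD fg.
have fD : P.-integrable D (EFin \o f) by apply: integrableS fi.
have gD : P.-integrable D (EFin \o g) by apply: integrableS gi.
have mfg : measurable_fun D (fun x => (g x - f x)%:E).
  apply/measurable_EFinP; apply: measurable_funB; apply/measurable_EFinP.
    exact: measurable_int gD.
  exact: measurable_int fD.
have : \int[P]_(x in D) `|(g x - f x)%:E| = 0.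
  rewrite (eq_integral (fun x => (g x)%:E - (f x)%:E)).
    rewrite (@integralB _ _ _ P D mD (EFin \o g) (EFin \o f))//.
    by rewrite /comp fg subee// (integrable_fin_num mD gD).
  by move=> x /set_mem Dx; rewrite gee0_abs// lee_fin subr_ge0 ltW.
move/(ae_eq_integral_abs P mD mfg) => [N [mN N0 sub]]; exists N; split => //.
move=> x Dx; apply: sub => /= h; have /eqP := h Dx.
by rewrite eqe subr_eq0 gt_eqF.
Qed.

End integrable_ae.

Section cond_exp_unique.
Context d (T : measurableType d) (R : realType).
Variable P : {measure set T -> \bar R}.
Hypothesis P1 : P setT = 1%E.
Variable K : set (set T).
Hypothesis sK : sigma_algebra setT K.
Hypothesis Kmeas : forall B, K B -> measurable B.

Lemma integral_bmf_set (f : T -> R) (C : set T) : measurable C -> bmf f ->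
  (\int[P]_(x in C) (f x)%:E = (mean P (fun x => \1_C x * f x))%:E)%E.
Proof.
move=> mC bf; have bC : bmf (\1_C : T -> R) by exact: bmf_indic.
apply: etrans (esym (EFin_mean P1 (bmfM bC bf))).
rewrite (integral_mkcond C (fun x => (f x)%:E)); apply: eq_integral => x _.
by rewrite patchE indicE; case: (x \in C); rewrite ?mul1r ?mul0r.
Qed.

Variables (A : set T) (e : T -> R).
Hypothesis mA : measurable A.
Hypothesis bKe : bmfK K e.
Hypothesis eC : forall B, K B -> mean P (fun x => \1_B x * (\1_A x - e x)) = 0.

Let be : bmf e. Proof. exact: (bmfK_bmf sK Kmeas). Qed.

Lemma cond_exp_integral C : K C ->
  (\int[P]_(x in C) (e x)%:E = \int[P]_(x in C) (\1_A x)%:E)%E.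
Proof.
move=> KC; have mC := Kmeas KC.
have bA : bmf (\1_A : T -> R) by exact: bmf_indic.
have bC : bmf (\1_C : T -> R) by exact: bmf_indic.
rewrite !integral_bmf_set//; congr EFin.
have := eC KC; under eq_mean do rewrite mulrBr.
by rewrite (meanB P1); [|by bm..]; move/eqP; rewrite subr_eq0 => /eqP.
Qed.

(** h is an arbitrary version, integrable but possibly unbounded. The sets h < e and e < h lie in K,
    so comparing integrals on them shows that both are negligible. *)
Lemma mean_entr_cond_exp (h : T -> R) : (forall x, 0 <= e x <= 1) ->
  (forall Y, measurable Y -> K (h @^-1` Y)) -> P.-integrable setT (EFin \o h) ->
  (forall C, K C -> \int[P]_(x in C) (h x)%:E = \int[P]_(x in C) (\1_A x)%:E)%E ->
  (\int[P]_x (entr_fun (h x))%:E)%E = (mean P (fun x => entr_fun (e x)))%:E.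
Proof.
move=> e01 hF ih hC.
have ie : P.-integrable setT (EFin \o e) by exact: bmf_integrable.
have mhK : measurable_fun [set: g_sigma_algebraType K] h.
  by move=> _ Y mY; rewrite setTI sigma_algebra_measurableE//; exact: hF.
have KD (f g : T -> R) : measurable_fun [set: g_sigma_algebraType K] f ->
    measurable_fun [set: g_sigma_algebraType K] g -> K [set x | f x < g x].
  move=> mf mg; have mfg := measurable_funB mg mf.
  have := mfg measurableT _ (measurable_itv `]0, +oo[).
  rewrite setTI sigma_algebra_measurableE//; congr K.
  by apply/seteqP; split => x /=; rewrite in_itv/= andbT subr_gt0.
have K1 := KD _ _ mhK bKe.1; have K2 := KD _ _ bKe.1 mhK.
have n1 : P.-negligible [set x | h x < e x].
  apply: integrable_gt_negligible => //; first exact: Kmeas.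
  by rewrite hC// cond_exp_integral.
have n2 : P.-negligible [set x | e x < h x].
  apply: integrable_gt_negligible => //; first exact: Kmeas.
  by rewrite hC// cond_exp_integral.
have mphi (f : T -> R) : measurable_fun setT f ->
    measurable_fun setT (fun x => (entr_fun (f x))%:E).
  move=> mf; apply/measurable_EFinP; apply: measurable_funN.
  by apply: measurable_funM => //; exact: measurableT_comp.
have be' : bmf (fun x => entr_fun (e x)) by exact: bmf_entr_fun.
apply: etrans (esym (EFin_mean P1 be')); apply: ae_eq_integral => //.
- by apply: mphi; apply/measurable_EFinP; exact: measurable_int ih.
- exact: mphi be.1.
have := negligibleU n1 n2; apply: negligibleS => x /= nh.
have [?|?|he] := ltgtP (h x) (e x); [by left|by right|].
by exfalso; apply: nh => _; rewrite he.
Qed.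

End cond_exp_unique.

(** * Sequence entropy of the completed system *)

Section sequence_entropy.
Context (R : realType) (X : ptopologicalType).
Variable mu : {measure set (borel_type X) -> \bar R}.
Hypothesis mu1 : mu setT = 1%E.
Variables (G : Type) (mul : G -> G -> G) (inv : G -> G) (act : G -> X -> X).
Hypothesis actM : forall g h x, act (mul g h) x = act g (act h x).
Hypothesis actV : forall g x, act g (act (inv g) x) = x.
Hypothesis act_cont : forall g, continuous (act g).
Hypothesis act_inv : forall g (B : set (borel_type X)), measurable B ->
     mu (act g @^-1` B) = mu B.

Let mu_fin : (mu setT < +oo)%E. Proof. by rewrite mu1 ltry. Qed.

Let act_borel g :
  measurable_fun [set: borel_type X] (act g : borel_type X -> borel_type X).
Proof.
apply: (@measurability _ _ (borel_type X) (borel_type X) setT (act g) (@open X) erefl).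
move=> _ [U oU <-]; rewrite setTI; apply: sub_sigma_algebra.
by apply: open_comp => // x _; exact: act_cont.
Qed.

Let P1 : mubar mu setT = 1%E.
Proof. by rewrite /mubar completion_measureE. Qed.

Let act_meas g : measurable_fun [set: cX mu] (act g : cX mu -> cX mu).
Proof. exact: (completion_measurable_fun mu_fin (act_borel g) (act_inv g)). Qed.

Let act_pres g (B : set (cX mu)) : measurable B ->
  mubar mu (act g @^-1` B) = mubar mu B.
Proof. exact: (completion_preserving mu_fin (act_borel g) (act_inv g)). Qed.

Local Notation K := (kron (mubar mu) act).

Lemma completed_measurableE (B : set X) :
  completed_measurable mu B <-> measurable (B : set (cX mu)).
Proof. by symmetry; exact: (completion_measurableP mu_fin). Qed.

(** For differences of indicators the squared L2 norm is the L1 norm, so the threshold e becomes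
    e^2. *)
Lemma Lnorm2_lt (D : cX mu -> R) e : bmf D -> (forall x, D x ^+ 2 = `|D x|) ->
  0 < e -> ('N[mubar mu]_(2%:E)[EFin \o D] < e%:E)%E <->
    mean (mubar mu) (fun x => `|D x|) < e ^+ 2.
Proof.
move=> bD D2 e0; rewrite unlock /=.
have -> : (\int[mubar mu]_x (`|(D x)%:E| `^ 2) =
    (mean (mubar mu) (fun x => `|D x|))%:E)%E.
  have bD' : bmf (fun x => `|D x|) by bm.
  apply: etrans (esym (EFin_mean P1 bD')).
  apply: eq_integral => x _; rewrite -D2 /= powR_mulrn// real_normK//.
  exact: num_real.
have m0 : 0 <= mean (mubar mu) (fun x => `|D x|) by apply: mean_ge0.
rewrite poweR_EFin lte_fin powR12_sqrt//.
by rewrite -(@ltr_pXn2r _ 2)// ?nnegrE ?sqrtr_ge0 ?(ltW e0)// sqr_sqrtr.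
Qed.

(** Finite L2 nets with centres in the orbit and finite L1 colourings determine each other: colour
    by a nearby centre, or take one representative per colour. *)
Lemma kroneckerE (g0 : G) : kronecker mu act = K.
Proof.
apply/seteqP; split => B [].
- move=> /completed_measurableE mB pB; split => // e e0.
  have e2 : 0 < e / 2 by rewrite divr_gt0.
  (* An L2 radius of sqrt (e / 2) is an L1 radius of e / 2, and two points near one centre are at
     distance below e. *)
  have se : 0 < Num.sqrt (e / 2) by rewrite sqrtr_gt0.
  have [m [fs [Sfs net]]] := pB _ se.
  have bI g : @bmf _ (cX mu) R (fun x => \1_B (act g x)).
    by apply: bmf_comp => //; exact: bmf_indic.
  have /choice[c hc] (g : G) : exists j : 'I_m,
      mean (mubar mu) (fun x => `|\1_B (act g x) - fs j x|) < e / 2.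
    have Sg : [set (fun x => \1_B (act g x)) | g in [set: G]]
        (fun x => \1_B (act g x) : R).
      by exists g.
    have [j hj] := net _ Sg; exists j; have [h _ hE] := Sfs j.
    have bD : @bmf _ (cX mu) R (fun x => \1_B (act g x) - fs j x).
      by rewrite -hE; exact: (bmfB (bI g) (bI h)).
    have D2 x : (\1_B (act g x) - fs j x) ^+ 2 = `|\1_B (act g x) - fs j x|.
      by rewrite -hE; exact: indic_sub_sqr.
    have [+ _] := Lnorm2_lt bD D2 se; rewrite sqr_sqrtr ?ltW//; exact.
  exists 'I_m, c => g h cgh.
  have hg := hc g; have hh := hc h; rewrite cgh in hg.
  have bj : @bmf _ (cX mu) R (fs (c h)) by have [k _ <-] := Sfs (c h); exact: bI.
  rewrite [ltRHS]splitr.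
  apply: le_lt_trans (ltrD hg hh).
  exact: (mean_dist_triangle P1 (bI g) bj (bI h)).
- move=> mB tB; split; first exact/completed_measurableE.
  move=> e e0; have [J [c hc]] := tB _ (exprn_gt0 2 e0).
  have /choice[rep hrep] (j : J) : exists g, forall g', c g' = j -> c g = j.
    have [[g' <-]|nj] := pselect (exists g', c g' = j); first by exists g'.
    by exists g0 => g' gj; case: nj; exists g'.
  have bI g : @bmf _ (cX mu) R (fun x => \1_B (act g x)).
    by apply: bmf_comp => //; exact: bmf_indic.
  exists #|J|, (fun j x => \1_B (act (rep (enum_val j)) x)); split.
    by move=> j; exists (rep (enum_val j)).
  move=> _ [g _ <-]; exists (enum_rank (c g)).
  rewrite enum_rankK; set h := rep (c g).
  have bD := bmfB (bI g) (bI h).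
  have [_ +] := Lnorm2_lt bD (fun x => indic_sub_sqr R B (act g x) (act h x)) e0.
  apply.
  by apply: hc; rewrite (hrep (c g) g).
Qed.

Let sK : sigma_algebra setT K.
Proof. exact: (kron_sigma_algebra P1 act_meas act_pres). Qed.
Let Kmeas (B : set (cX mu)) : K B -> measurable B. Proof. by case. Qed.

Lemma entr_cond_exp (A : set X) (e : X -> R) : measurable (A : set (cX mu)) ->
  bmfK K (e : cX mu -> R) -> (forall x, 0 <= e x <= 1) ->
  (forall B, K B -> mean (mubar mu) (fun x => \1_B x * (\1_A x - e x)) = 0) ->
  (\int[mubar mu]_x (entr_fun (cond_exp mu K (\1_A) x))%:E)%E =
  (mean (mubar mu) (fun x => entr_fun (e x)))%:E.
Proof.
move=> mA bKe e01 eC.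
have eP : is_cond_exp mu K (\1_A) e.
  split; first by move=> B mB; exact: (bmfK_preimage sK bKe).
    exact: (bmf_integrable P1 (bmfK_bmf sK Kmeas bKe)).
  exact: (cond_exp_integral P1 sK Kmeas mA bKe eC).
(* The version e shows that the default branch of [cond_exp] is not reached. *)
rewrite /cond_exp; case: pselect => [ex|]; last by case; exists e.
case: (cid ex) => h /= [hF ih hC].
exact: (mean_entr_cond_exp P1 sK Kmeas mA bKe eC e01 hF ih hC).
Qed.

Variables (k : nat) (A : 'I_k -> set X).
Hypothesis partA : is_finite_partition mu A.

Lemma seq_entropy_star_cond_entropy (g0 : G) :
  seq_entropy_star mu act A = cond_entropy mu A (kronecker mu act).
Proof.
have [mA dA UA] := partA; rewrite (kroneckerE g0).
have mA' i : measurable (A i : set (cX mu)) by exact/completed_measurableE.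
(* The partition is encoded by its label function; disjointness makes A i the fibre of a over i. *)
have /choice[a Aa] (x : X) : exists i, A i x.
  have : (\bigcup_i A i) x by rewrite UA.
  by case=> i _ Ai; exists i.
have aP i x : A i x <-> a x = i.
  split=> [Aix|<-//]; apply/eqP/negPn/negP => ai.
  by have : (A (a x) `&` A i) x by []; rewrite dA.
have AE i : A i = [set x | a x == i].
  by apply/seteqP; split => x; [move/aP => <- /=|move/eqP/aP].
have ma : @mlab _ (cX mu) _ a by move=> i; rewrite -AE; exact: mA'.
have /choice[e he] (i : 'I_k) := cond_exp_exists P1 sK Kmeas (mA' i).
have bKe i : bmfK K (e i) by case: (he i).
have e01 i x : 0 <= e i x <= 1 by case: (he i) => _ /(_ x).
have eC i B : K B -> mean (mubar mu) (fun x => \1_B x * ((a x == i)%:R - e i x)) = 0.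
  case: (he i) => _ _ + KB => /(_ B KB) <-; apply: eq_mean => x.
  by rewrite AE indic_bool.
pose m := mean_entropy (mubar mu) e.
have -> : cond_entropy mu A K = m%:E.
  rewrite /cond_entropy /m /mean_entropy -sumEFin; apply: eq_bigr => i _.
  by apply: entr_cond_exp => //; case: (he i).
have HE (s : nat -> G) n : entropy mu (join_atom act A s (n := n)) =
    H (mubar mu) (join (fun i (x : cX mu) => a (act (s i) x)) n).
  have mj : mlab (join (fun i (x : cX mu) => a (act (s i) x)) n).
    by apply: mlab_join => i; exact: (mlab_act act_meas (s i) ma).
  apply: eq_bigr => c _; congr entr_fun.
  apply: etrans (esym (@mean_bool _ _ _ (mubar mu) _ (mj c))).
  congr (fine (mubar mu _)); apply/seteqP; split => x /= h.
    by apply/eqP/ffunP => i; rewrite ffunE; apply/aP; exact: h.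
  by move=> i; apply/aP; rewrite -(eqP h) ffunE.
apply/eqP; rewrite eq_le; apply/andP; split.
  apply: ge_ereal_sup => _ [s _ <-]; apply/lee_addgt0Pr => r r0.
  have r2 : 0 < r / 2 by rewrite divr_gt0.
  have [C hC] := join_upper_bound P1 act_meas act_pres ma bKe e01 eC g0 r2.
  (* For n >= N the constant contributes at most r / 2 after division by n; since N >= 1, n is
     nonzero. *)
  pose N := (Num.truncn (`|C| / (r / 2))).+1.
  apply: (@le_trans _ _ (ereal_sup ((fun n => ((n%:R)^-1 *
      entropy mu (join_atom act A s (n:=n)))%:E) @` [set n | (N <= n)%N]))).
    by apply: ereal_inf_lbound; exists [set n | (N <= n)%N] => //; exists N.
  apply: ge_ereal_sup => _ [n /= Nn <-]; rewrite -EFinD lee_fin HE.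
  have n0 : 0 < n%:R :> R by rewrite ltr0n (leq_trans _ Nn).
  rewrite ler_pdivrMl//; apply: le_trans (hC s n) _.
  have : `|C| / (r / 2) < n%:R.
    by apply: lt_le_trans (_ : N%:R <= _); [exact: truncnS_gt|rewrite ler_nat].
  rewrite ltr_pdivrMr// => hn; have := ler_norm C; rewrite -/m.
  by move: `|C| hn => y; lra.
apply/lee_addgt0Pr => r r0.
have [s hs] := join_lower_bound P1 actM actV act_meas act_pres ma bKe e01 eC g0 r0.
rewrite -leeBlDr//; apply: le_trans (_ : (seq_entropy mu act A s <= _)%E); last first.
  by apply: ereal_sup_ubound; exists s.
(* The upper limit is an infimum of suprema over neighbourhoods V of infinity; the index N + 1 lies
   in V and avoids division by zero. *)
apply: le_ereal_inf_tmp => _ [V [N _ NV] <-].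
apply: (@le_trans _ _ ((N.+1%:R)^-1 * entropy mu (join_atom act A s (n:=N.+1)))%:E);
  last first.
  by apply: ereal_sup_ubound; exists N.+1 => //; apply: NV => /=.
rewrite -EFinB lee_fin HE ler_pdivlMl//; exact: hs.
Qed.

End sequence_entropy.

Theorem theoremB3 (R : realType)
    (G : countType) (mul : G -> G -> G) (one : G) (inv : G -> G)
    (X : pseudoPMetricType R) (act : G -> X -> X)
    (mu : probability (borel_type X) R)
    (k : nat) (A : 'I_k -> set X) :
  is_group mul one inv ->
  infinite_set [set: G] ->
  hausdorff_space X ->
  compact [set: X] ->
  is_action mul one act ->
  (forall g, continuous (act g)) ->
  (forall g (B : set (borel_type X)), measurable B ->
     mu (act g @^-1` B) = mu B) ->
  is_finite_partition mu A ->
  seq_entropy_star mu act A = cond_entropy mu A (kronecker mu act).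
Proof.
move=> [_ _ _ _ mulV] _ _ _ [act1 actM] act_cont act_inv partA.
have actV g x : act g (act (inv g) x) = x by rewrite -actM mulV act1.
exact: (seq_entropy_star_cond_entropy (@probability_setT _ _ _ mu)
  actM actV act_cont act_inv partA one).
Qed.
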